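(* Let $N,L\ge 1$, let $\Phi\in\mathbb{R}^{N\times L}$ be a known matrix and $\sigma^2>0$ known. Let $\gamma=(\gamma_1,\dots,\gamma_L)^T\in(0,\infty)^L$ be an unknown deterministic parameter, $\Upsilon=\mathrm{diag}(\gamma_1,\dots,\gamma_L)$, and consider $y=\Phi x+n$ with $x\sim\mathcal{N}(0,\Upsilon)$ and $n\sim\mathcal{N}(0,\sigma^2 I_N)$ independent. Then the hybrid Cramér-Rao bound on the MSE matrix $\mathbf{E}^\theta$ of the unknown vector $\theta=[x^T,\gamma^T]^T\in\mathbb{R}^{2L}$ is $\mathbf{E}^\theta\succeq(\mathbf{H}^\theta)^{-1}$, where the hybrid information matrix $\mathbf{H}^\theta$ is $$\mathbf{H}^{\theta}=\begin{bmatrix}\frac{\Phi^T\Phi}{\sigma^2}+\Upsilon^{-1} & \mathbf{0}_{L\times L}\\ \mathbf{0}_{L\times L} & \mathrm{diag}(2\gamma_1^2,2\gamma_2^2,\dots,2\gamma_L^2)^{-1}\end{bmatrix}.$$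
   Context: $A\succeq B$ means $A-B$ is positive semidefinite. Let $p(y,x;\gamma)$ be the joint density of $(y,x)$ for the parameter $\gamma$, and let $\mathbb{E}_{Y,X;\gamma}$ denote expectation with respect to it. The hybrid information matrix is $\mathbf{H}^\theta=-\mathbb{E}_{Y,X;\gamma}[\nabla_\theta\nabla_\theta^T\log p(y,x;\gamma)]$, where derivatives are taken with respect to all components of $\theta=[x^T,\gamma^T]^T$. For an estimator $\hat\theta(y)\in\mathbb{R}^{2L}$ of $\theta$, a function of the observations $y$, the MSE matrix is $\mathbf{E}^\theta=\mathbb{E}_{Y,X;\gamma}[(\theta-\hat\theta(y))(\theta-\hat\theta(y))^T]$. It is assumed that the MSE matrix exists and that the information matrix is non-singular.
   Formalization: The bound is proved for measurable estimators that are unbiased, i.e. the mean of θ − θ̂(y) over (y,x) exists and is 0 for every γ in (0,∞)^L; without unbiasedness it fails, e.g. for a constant estimator whose γ-part equals the true γ. *)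

(* Defs.v *)
From HB Require Import structures.
From mathcomp Require Import all_boot all_order all_algebra.
From mathcomp Require Import all_classical all_reals all_analysis.

Set Implicit Arguments.
Unset Strict Implicit.
Unset Printing Implicit Defensive.

Import Order.TTheory GRing.Theory Num.Theory.
Import numFieldNormedType.Exports.

Local Open Scope classical_set_scope.
Local Open Scope ring_scope.

(* Column vectors carry the product sigma-algebra, generated by the
   coordinates; it is the Borel sigma-algebra when T is the real line. *)

Definition measure_cV_display : measure_display -> measure_display.
Proof. exact. Qed.

Section measurable_cV.
Context {d} {T : measurableType d} (n : nat).

Let coord (i : 'I_n) (v : 'cV[T]_n) : T := v i ord0.

Let cV_set0 : g_sigma_preimage coord set0.
Proof. exact: sigma_algebra0. Qed.

Let cV_setC A : g_sigma_preimage coord A -> g_sigma_preimage coord (~` A).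
Proof. exact: sigma_algebraC. Qed.

Let cV_bigcup (F : (set 'cV[T]_n)^nat) :
  (forall i, g_sigma_preimage coord (F i)) ->
  g_sigma_preimage coord (\bigcup_i F i).
Proof. exact: sigma_algebra_bigcup. Qed.

HB.instance Definition _ := @isMeasurable.Build (measure_cV_display d)
  'cV[T]_n (g_sigma_preimage coord) cV_set0 cV_setC cV_bigcup.

End measurable_cV.

Lemma measurable_coord d (T : measurableType d) n (i : 'I_n) :
  measurable_fun [set: 'cV[T]_n] (fun v : 'cV[T]_n => v i ord0).
Proof.
move=> _ Y mY; rewrite setTI; apply: sub_sigma_algebra => /=.
rewrite -bigcup_seq/=; exists i => /=; first by rewrite mem_index_enum.
by exists Y => //; rewrite setTI.
Qed.

Lemma measurable_fun_cVP d1 d2 (T1 : measurableType d1)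
    (T2 : measurableType d2) n (f : T1 -> 'cV[T2]_n) :
  measurable_fun [set: T1] f <->
  forall i, measurable_fun [set: T1] (fun t => f t i ord0).
Proof.
split=> [mf i|mf].
  by apply: (measurableT_comp (measurable_coord i)).
apply: measurability => //=.
move=> _ [A /= + <-]; rewrite -bigcup_seq => -[i _ [B mB <-]].
rewrite !setTI; have := mf i measurableT B mB.
by rewrite setTI.
Qed.

Section lebesgue_cV.
Context {R : realType}.

Definition cons_cV n (p : R * 'cV[R]_n) : 'cV[R]_n.+1 := col_mx p.1%:M p.2.

Definition uncons_cV n (v : 'cV[R]_n.+1) : R * 'cV[R]_n :=
  (v ord0 ord0, dsubmx (v : 'cV_(1 + n))).

Lemma cons_cVK n : cancel (@uncons_cV n) (@cons_cV n).
Proof.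
move=> v; rewrite /cons_cV /uncons_cV /= -[RHS](@vsubmxK _ 1 n 1 v).
congr (@col_mx _ 1 n 1 _ _); apply/matrixP => i j.
rewrite !mxE !ord1 eqxx mulr1n.
by congr (v _ _); apply/val_inj.
Qed.

Lemma uncons_cVK n : cancel (@cons_cV n) (@uncons_cV n).
Proof.
move=> [a v]; rewrite /cons_cV /uncons_cV /= col_mxKd; congr pair.
rewrite (_ : ord0 = lshift n (ord0 : 'I_1)); last exact/val_inj.
by rewrite (@col_mxEu _ 1 n) mxE eqxx.
Qed.

Lemma measurable_cons_cV n : measurable_fun [set: R * 'cV[R]_n] (@cons_cV n).
Proof.
apply/measurable_fun_cVP => i.
have [j|j] := @splitP 1 n i => ij.
  rewrite (_ : (fun t => _) = fst); first exact: measurable_fst.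
  apply/funext => t; rewrite (_ : i = lshift n j); last exact/val_inj.
  by rewrite (@col_mxEu _ 1 n) mxE ord1 eqxx.
rewrite (_ : (fun t => _) = (fun v : 'cV[R]_n => v j ord0) \o snd).
  by apply: measurableT_comp => //; exact: measurable_coord.
apply/funext => t; rewrite (_ : i = rshift 1 j); last exact/val_inj.
by rewrite (@col_mxEd _ 1 n).
Qed.

Lemma measurable_uncons_cV n :
  measurable_fun [set: 'cV[R]_n.+1] (@uncons_cV n).
Proof.
apply/measurable_fun_pairP; split; first exact: measurable_coord.
apply/measurable_fun_cVP => i /=.
rewrite (_ : (fun t => _) = fun t : 'cV[R]_n.+1 => t (rshift 1 i) ord0).
  exact: (measurable_coord (rshift 1 i : 'I_n.+1)).
by apply/funext => t; rewrite mxE.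
Qed.

(* Lebesgue measure on R^n, as the n-fold product of the measure on R *)
Fixpoint lebesgue_cV n : set 'cV[R]_n -> \bar R :=
  if n is m.+1 then
    pushforward (@lebesgue_measure R \x @lebesgue_cV m)%E (@cons_cV m)
  else @dirac _ 'cV[R]_0 0 R.

Let lebesgue_cV_measure n :
  exists mu : {sigma_finite_measure set 'cV[R]_n -> \bar R},
    @lebesgue_cV n = mu.
Proof.
elim: n => [|n [mu muE]]; first by exists (@dirac _ 'cV[R]_0 0 R).

pose lam := @lebesgue_measure R.
pose nu := (lam \x mu)%E.
have /sigma_finiteP[F [TF ndF Foo]] := sigma_finiteT lam.
have /sigma_finiteP[G [TG ndG Goo]] := sigma_finiteT mu.
have sf : sigma_finite setT (pushforward nu (@cons_cV n)).
  exists (fun k => @uncons_cV n @^-1` (F k `*` G k)).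
    rewrite -preimage_bigcup (_ : \bigcup_k _ = setT) ?preimage_setT//.
    rewrite -setXTT TF TG predeqE => -[x y]; split.
      by move=> [k _ []/= ? ?]; split; exists k.
    move=> [/= [k _ Fkx] [l _ Gly]]; exists (maxn k l) => //; split.
    - by move: x Fkx; exact/subsetPset/ndF/leq_maxl.
    - by move: y Gly; exact/subsetPset/ndG/leq_maxr.
  move=> k; have [mF Fk] := Foo k; have [mG Gk] := Goo k; split.
    rewrite -[X in measurable X]setTI; apply: measurable_uncons_cV => //.
    exact: measurableX.
  rewrite /pushforward -comp_preimage (_ : _ \o _ = id) ?preimage_id.
    by rewrite /nu product_measure1E// lte_mul_pinfty// ge0_fin_numE.
  by apply/funext => p /=; rewrite uncons_cVK.
pose m0 : {measure set 'cV[R]_n.+1 -> \bar R} :=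
  measure_function_pushforward__canonical__measure_function_Measure nu
    (@measurable_cons_cV n).
pose h := Measure_isSigmaFinite.Build _ _ _ m0 sf.
pose m : {sigma_finite_measure set 'cV[R]_n.+1 -> \bar R} :=
  HB.pack (Measure.sort m0) m0 h.
by exists m; rewrite /= muE.
Qed.

Let lebesgue_cV0 n : @lebesgue_cV n set0 = 0%E.
Proof. by have [mu ->] := lebesgue_cV_measure n; exact: measure0. Qed.

Let lebesgue_cV_ge0 n A : (0 <= @lebesgue_cV n A)%E.
Proof. by have [mu ->] := lebesgue_cV_measure n; exact: measure_ge0. Qed.

Let lebesgue_cV_sigma_additive n : semi_sigma_additive (@lebesgue_cV n).
Proof.
by have [mu ->] := lebesgue_cV_measure n; exact: measure_semi_sigma_additive.
Qed.

HB.instance Definition _ n := isMeasure.Build _ _ _ (@lebesgue_cV n)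
  (@lebesgue_cV0 n) (@lebesgue_cV_ge0 n) (@lebesgue_cV_sigma_additive n).

Let lebesgue_cV_sigma_finite n : sigma_finite setT (@lebesgue_cV n).
Proof. by have [mu ->] := lebesgue_cV_measure n; exact: sigma_finiteT. Qed.

HB.instance Definition _ n := Measure_isSigmaFinite.Build _ _ _
  (@lebesgue_cV n) (@lebesgue_cV_sigma_finite n).

End lebesgue_cV.
Arguments lebesgue_cV {R} n.

Section expectation_mx.
Context d (Omega : measurableType d) (R : realType) (P : probability Omega R).
Context (m n : nat).
Implicit Type M : Omega -> 'M[R]_(m, n).

Definition integrable_mx M : Prop :=
  forall i j, P.-integrable setT (fun w => (M w i j)%:E).

Definition expectation_mx M : 'M[R]_(m, n) :=
  \matrix_(i, j) fine 'E_P[fun w => M w i j].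

End expectation_mx.

Section random_vectors.
Context d (Omega : measurableType d) (R : realType) (P : probability Omega R).

Definition has_density d' (T : measurableType d') (mu : set T -> \bar R)
    (Z : Omega -> T) (p : T -> R) : Prop :=
  forall A, measurable A -> pushforward P Z A = (\int[mu]_(t in A) (p t)%:E)%E.

Definition independent d1 d2 (T1 : measurableType d1) (T2 : measurableType d2)
    (Z1 : Omega -> T1) (Z2 : Omega -> T2) : Prop :=
  forall A B, measurable A -> measurable B ->
    P (Z1 @^-1` A `&` Z2 @^-1` B) = (P (Z1 @^-1` A) * P (Z2 @^-1` B))%E.

End random_vectors.

(* Meaningful for positive definite S only: a degenerate Gaussian has no
   density with respect to Lebesgue measure. *)
Definition gaussian_pdf (R : realType) n (m : 'cV[R]_n) (S : 'M[R]_n)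
    (v : 'cV[R]_n) : R :=
  (Num.sqrt ((2 * pi) ^+ n * \det S))^-1 *
  expR (- ((v - m)^T *m invmx S *m (v - m)) ord0 ord0 / 2).

Definition gaussian d (Omega : measurableType d) (R : realType)
    (P : probability Omega R) n (Z : Omega -> 'cV[R]_n) (m : 'cV[R]_n)
    (S : 'M[R]_n) : Prop :=
  has_density P (lebesgue_cV n) Z (gaussian_pdf m S).

Definition psd (R : realType) n (A : 'M[R]_n) : Prop :=
  A^T = A /\ forall v : 'cV[R]_n, 0 <= (v^T *m A *m v) ord0 ord0.

Definition loewner_ge (R : realType) n (A B : 'M[R]_n) : Prop := psd (A - B).

Definition hessian (R : realType) n (f : 'cV[R]_n -> R) (t : 'cV[R]_n) :
    'M[R]_n :=
  \matrix_(i, j) 'D_(delta_mx i ord0) ('D_(delta_mx j ord0) f) t.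

Section hybrid_estimation.
Context d (Omega : measurableType d) (R : realType) (P : probability Omega R).
Context (N L K : nat) (Y : Omega -> 'cV[R]_N) (X : Omega -> 'cV[R]_L).
Variable g : 'cV[R]_K.

(* The random parameter X stacked on the deterministic parameter g *)
Definition hybrid_parameter (w : Omega) : 'cV[R]_(L + K) := col_mx (X w) g.

(* p y x g is the joint density at (y, x) for the parameter g *)
Definition hybrid_information_mx
    (p : 'cV[R]_N -> 'cV[R]_L -> 'cV[R]_K -> R) : 'M[R]_(L + K) :=
  - expectation_mx P (fun w =>
      hessian (fun t => ln (p (Y w) (usubmx t) (dsubmx t)))
        (hybrid_parameter w)).

Variable est : 'cV[R]_N -> 'cV[R]_(L + K).

Definition estimation_error (w : Omega) : 'cV[R]_(L + K) :=
  hybrid_parameter w - est (Y w).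

Definition squared_error_mx (w : Omega) : 'M[R]_(L + K) :=
  estimation_error w *m (estimation_error w)^T.

Definition mse_mx : 'M[R]_(L + K) := expectation_mx P squared_error_mx.

(* The mean is taken over X as well: est need not be unbiased conditionally
   on the value of X. *)
Definition hybrid_unbiased : Prop :=
  integrable_mx P estimation_error /\ expectation_mx P estimation_error = 0.

End hybrid_estimation.

Section sparse_linear_model.
Context (R : realType) (N L : nat) (Phi : 'M[R]_(N, L)) (sigma2 : R).

Definition positive_cV (g : 'cV[R]_L) : Prop := forall i, 0 < g i ord0.

Definition Upsilon (g : 'cV[R]_L) : 'M[R]_L := diag_mx g^T.

(* Density of y given x, times the density of x *)
Definition joint_pdf (y : 'cV[R]_N) (x g : 'cV[R]_L) : R :=
  gaussian_pdf (Phi *m x) sigma2%:M y * gaussian_pdf 0 (Upsilon g) x.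

Definition observation (Omega : Type) (X : Omega -> 'cV[R]_L)
    (noise : Omega -> 'cV[R]_N) (w : Omega) : 'cV[R]_N :=
  Phi *m X w + noise w.

End sparse_linear_model.

(* Main.v *)
Require Import Defs.
From mathcomp Require Import all_boot all_order all_algebra.
From mathcomp Require Import all_classical all_reals all_analysis.
From mathcomp Require Import measurable_realfun.
From mathcomp Require Import ring lra.
Import Order.TTheory GRing.Theory Num.Theory.
Import numFieldNormedType.Exports.
Local Open Scope classical_set_scope.
Local Open Scope ring_scope.

(** Write [e] for the estimation error and [s] for the gradient of the log
    density in [(x, gamma)].  If [E[s s^T] = H] and [E[e s^T] = -1], then
    [0 <= E[(v^T e + v^T H^-1 s)^2] = v^T (E[e e^T] - H^-1) v].  Both moments are
    computed by perturbing the law of [(noise, x)]: the likelihood ratio of a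
    perturbation of size [h] is [1 + h s + o(h)] in [L2].  For the [x]-components
    of [s] the perturbation is the translation of [(noise, x)] by
    [h (- Phi e_j, e_j)], which leaves [y = Phi x + noise] unchanged; for the
    [gamma]-components it changes the variance [gamma_j], and the unbiasedness at
    the perturbed parameter gives the value of the expectation. *)

(** * Translation invariance of Lebesgue measure on column vectors *)

(** The obstacle is that [est] is merely measurable and its error is known to be square-integrable
    at the true parameter only, so neither the estimator nor its expectation near [gamma] can be
    differentiated. All regularity is therefore put on the likelihood ratio: a perturbed expectation
    is rewritten under [P gamma], and the difference quotient of the ratio is dominated by a
    square-integrable [D] that does not involve the estimator. The perturbed expectation is known
    exactly (affine in the translation or in the variance), so the limit of the quotients is known
    as well. One-sided perturbations [1/(n+1)] suffice for this, and that leaves the freedom to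
    perturb the variance downwards only. The same mechanism, applied to constants and coordinates,
    yields every Gaussian moment without evaluating a Gaussian integral. The matrix H is reached
    twice, as minus the mean Hessian and as the second moment of the score; both are computed entry
    by entry and compared with the same explicit block matrix. *)

Lemma ge0_integral_lebesgue_measure_shift {R : realType} (a : R)
    (f : R -> \bar R) : measurable_fun [set: R] f -> (forall x, 0 <= f x)%E ->
  (\int[lebesgue_measure]_x f (x + a)%R = \int[lebesgue_measure]_x f x)%E.
Proof.
move=> mf f0.
have ms : measurable_fun [set: measurableTypeR R] (fun x : R => (x + a)%R : measurableTypeR R).
  by apply: measurable_funD => //; exact: measurable_id.
rewrite -(@ge0_integral_pushforward _ _ _ _ _ _ ms lebesgue_measure setT f)//.
apply: eq_measure_integral => A mA _.
pose mu : {measure set (measurableTypeR R) -> \bar R} :=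
  measure_function_pushforward__canonical__measure_function_Measure
   (@lebesgue_measure R) ms.
(* The image of Lebesgue measure under a translation has the same values on half-open intervals,
   hence is Lebesgue measure. *)
rewrite -(lebesgue_measure_unique (mu := mu))// => X [[x y] _ <-].
rewrite /mu /= /pushforward.
rewrite (_ : _ @^-1` _ = [set` `]x - a, y - a]]).
  rewrite !lebesgue_measure_itv/= !lte_fin ltrD2r.
  by case: ifP => // _; rewrite -!EFinB opprB addrA subrK.
by apply/seteqP; split => z /=; rewrite !in_itv/= ltrBlDr lerBrDr.
Qed.

Lemma measurable_addv {R : realType} n (a : 'cV[R]_n) :
  measurable_fun [set: 'cV[R]_n] (fun v => v + a).
Proof.
apply/measurable_fun_cVP => i; under eq_fun do rewrite mxE.
by apply: measurable_funD => //; exact: measurable_coord.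
Qed.

(** Induction on the dimension: through [cons_cV] the measure is a product, Tonelli separates the
    first coordinate from the others, and the shift acts on each factor separately. *)
Lemma ge0_integral_lebesgue_cV_shift {R : realType} n (a : 'cV[R]_n)
    (f : 'cV[R]_n -> \bar R) :
  measurable_fun [set: 'cV[R]_n] f -> (forall x, 0 <= f x)%E ->
  (\int[lebesgue_cV n]_v f (v + a)%R = \int[lebesgue_cV n]_v f v)%E.
Proof.
elim: n a f => [|n IH] a f mf f0.
  by apply: eq_integral => v _; rewrite (flatmx0 (v + a)) (flatmx0 v).
have mfa : measurable_fun [set: 'cV[R]_n.+1] (fun v => f (v + a)).
  by apply: measurableT_comp => //; exact: measurable_addv.
have IE g : measurable_fun [set: 'cV[R]_n.+1] g -> (forall x, 0 <= g x)%E ->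
    (\int[lebesgue_cV n.+1]_v g v = \int[lebesgue_measure]_x
      \int[lebesgue_cV n]_v g (cons_cV (x, v)))%E.
  move=> mg g0.
  transitivity (\int[pushforward (@lebesgue_measure R \x @lebesgue_cV R n)
    (@cons_cV R n)]_v g v)%E; first by [].
  have mc := @measurable_cons_cV R n.
  rewrite ge0_integral_pushforward// preimage_setT fubini_tonelli1//.
    exact: measurableT_comp.
  by move=> x; exact: g0.
rewrite (IE _ mfa (fun v => f0 _)) (IE _ mf f0).
have shiftE x v : cons_cV (x, v) + a =
    cons_cV (x + (uncons_cV a).1, v + (uncons_cV a).2).
  rewrite -{1}(cons_cVK a) /cons_cV /= (@add_col_mx _ 1 n).
  by rewrite -raddfD.
under eq_integral do under eq_integral do rewrite shiftE.
have mf2 : measurable_fun setT (fun p : R * 'cV[R]_n => f (cons_cV p)).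
  by apply: measurableT_comp => //; exact: measurable_cons_cV.
rewrite (ge0_integral_lebesgue_measure_shift (uncons_cV a).1 (fun x =>
  \int[lebesgue_cV n]_v f (cons_cV (x, (v + (uncons_cV a).2)%R)))%E); first last.
- by move=> x; exact: integral_ge0.
- apply: (@measurable_fun_fubini_tonelli_F _ _ _ _ _ (lebesgue_cV n)
    (fun p : R * 'cV[R]_n => f (cons_cV (p.1, p.2 + (uncons_cV a).2)))) => //.
  apply: (measurableT_comp mf2); apply/measurable_fun_pairP; split => /=.
    exact: measurable_fst.
  have ma := measurable_addv n (uncons_cV a).2.
  apply: (@measurableT_comp _ _ _ _ _ _ _ _ (@snd R 'cV[R]_n) ma).
  exact: measurable_snd.
apply: eq_integral => x _.
rewrite (IH _ (fun v => f (cons_cV (x, v))))//.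
exact: measurableT_comp mf2 (measurable_pair1 x).
Qed.

(** * Densities *)

Section density.
Context d (Omega : measurableType d) (R : realType) (P : probability Omega R).
Context d' (T : measurableType d') (mu : {measure set T -> \bar R}).
Variables (Z : Omega -> T) (p : T -> R).
Hypotheses (mZ : measurable_fun setT Z) (mp : measurable_fun setT p)
  (p0 : forall t, 0 <= p t) (dZ : has_density P mu Z p).

Import HBNNSimple.
Local Open Scope ereal_scope.

(** [has_density] speaks of sets only. Increasing simple approximations of [f] and monotone
    convergence on both sides reduce the formula to indicators, where it is that hypothesis. *)
Lemma ge0_integral_density (f : T -> \bar R) :
  measurable_fun setT f -> (forall t, 0 <= f t) ->
  \int[P]_w f (Z w) = \int[mu]_t (f t * (p t)%:E).
Proof.
move=> mf f0; have mp' : measurable_fun setT (EFin \o p) by exact/measurable_EFinP.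
pose h := nnsfun_approx measurableT mf.
have fE x : f x = lim ((EFin \o h n) x @[n --> \oo]).
  by apply/esym/cvg_lim => //; exact: cvg_nnsfun_approx.
have fpE x : f x * (p x)%:E = lim ((((EFin \o h n) x) * (p x)%:E) @[n --> \oo]).
  by apply/esym/cvg_lim => //; apply: cvgeZr => //; exact: cvg_nnsfun_approx.
transitivity (\int[P]_w lim ((EFin \o h n) (Z w) @[n --> \oo])).
  by apply: eq_integral => w _; rewrite fE.
transitivity (\int[mu]_t
    lim ((EFin \o h n) t * (p t)%:E @[n --> \oo])); last first.
by apply: eq_integral => t _; rewrite fpE.
rewrite monotone_convergence//; first last.
- by move=> w _ a b ab; rewrite lee_fin; exact/lefP/nd_nnsfun_approx.
- by move=> n w _; rewrite lee_fin.
- by move=> n; apply/measurable_EFinP; exact: measurableT_comp.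
rewrite monotone_convergence//; first last.
- by move=> x _ a b ab; rewrite lee_wpmul2r ?lee_fin ?p0//; exact/lefP/nd_nnsfun_approx.
- by move=> n x _; rewrite mule_ge0// lee_fin.
- by move=> n; apply: emeasurable_funM => //; exact/measurable_EFinP.
suff suf n : \int[P]_w (EFin \o h n) (Z w) =
    \int[mu]_t ((EFin \o h n) t * (p t)%:E) by under eq_fun do rewrite suf.
transitivity (\int[P]_w (\sum_(y \in range (h n))
    (y * \1_(h n @^-1` [set y]) (Z w))%:E)).
  by apply: eq_integral => w _; rewrite /= fimfunE -fsumEFin.
transitivity (\int[mu]_t (\sum_(y \in range (h n))
    ((y * \1_(h n @^-1` [set y]) t)%:E * (p t)%:E))); last first.
  apply: eq_integral => t _; rewrite /= fimfunE -fsumEFin// ge0_mule_fsuml//.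
  by move=> y; exact: nnfun_muleindic_ge0.
rewrite ge0_integral_fsum//; first last.
- by move=> r w _; exact: nnfun_muleindic_ge0.
- move=> r; apply/measurable_EFinP/measurable_funM => //.
  by apply: (measurableT_comp _ mZ).
rewrite ge0_integral_fsum//; first last.
- by move=> r w _; rewrite mule_ge0 ?lee_fin//; exact: nnfun_muleindic_ge0.
- by move=> r; apply: emeasurable_funM => //; exact/measurable_EFinP/measurable_funM.
apply: eq_fsbigr => r rh.
have [y _ hy] := set_mem rh.
have r0 : (0 <= r)%R by rewrite -hy.
have mA : measurable (h n @^-1` [set r]).
  rewrite -[X in measurable X]setTI.
  by apply: (measurable_funP (h n)) => //; exact: measurable_set1.
have mZA : measurable (Z @^-1` (h n @^-1` [set r])).
  by rewrite -[X in measurable X]setTI; exact: mZ.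
transitivity (\int[P]_w (r%:E * (\1_(h n @^-1` [set r]) (Z w))%:E)).
  by apply: eq_integral => w _; rewrite EFinM.
transitivity (\int[mu]_t (r%:E * ((\1_(h n @^-1` [set r]) t)%:E * (p t)%:E)));
  last first.
  by apply: eq_integral => t _; rewrite EFinM muleA.
rewrite ge0_integralZl_EFin//; first last.
- apply/measurable_EFinP.
  by apply: (measurableT_comp (measurable_indic _)).
rewrite ge0_integralZl_EFin//; first last.
- by apply: emeasurable_funM => //; exact/measurable_EFinP.
- by move=> w _; rewrite mule_ge0 ?lee_fin.
congr (_ * _).
transitivity (pushforward P Z (h n @^-1` [set r])).
  rewrite (_ : (fun x => _) = (fun w => (\1_(Z @^-1` (h n @^-1` [set r])) w)%:E)) //.
  by rewrite integral_indic// setIT.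
rewrite dZ// integral_mkcond; apply: eq_integral => t _.
by rewrite patchE indicE; case: ifP => _; rewrite ?mul1e ?mul0e.
Qed.

Lemma integral_density (f : T -> \bar R) : measurable_fun setT f ->
  \int[P]_w f (Z w) = \int[mu]_t (f t * (p t)%:E).
Proof.
move=> mf; rewrite [LHS]integralE [RHS]integralE.
rewrite (_ : (fun w => f (Z w))^\+ = fun w => f^\+ (Z w));
  last by apply/funext => w; rewrite !funeposE.
rewrite (_ : (fun w => f (Z w))^\- = fun w => f^\- (Z w));
  last by apply/funext => w; rewrite !funenegE.
rewrite !ge0_integral_density//; [|exact: measurable_funeneg|exact: measurable_funepos].
congr (_ - _); apply: eq_integral => t _.
- by rewrite !funeposE maxe_pMl ?lee_fin// mul0e.
- by rewrite !funenegE -mulNe maxe_pMl ?lee_fin// mul0e.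
Qed.

End density.

(** Independence says that the joint law agrees with the product of the two marginal laws on
    rectangles, so they are equal by uniqueness of the product measure; Tonelli then splits the
    double integral. *)
Lemma has_density_pair d (Omega : measurableType d) {R : realType}
    (P : probability Omega R) d1 (T1 : measurableType d1)
    d2 (T2 : measurableType d2) (mu1 : {sigma_finite_measure set T1 -> \bar R})
    (mu2 : {sigma_finite_measure set T2 -> \bar R})
    (Z1 : {mfun Omega >-> T1}) (Z2 : {mfun Omega >-> T2})
    (p1 : T1 -> R) (p2 : T2 -> R) :
  measurable_fun setT p1 -> measurable_fun setT p2 ->
  (forall t, 0 <= p1 t) -> (forall t, 0 <= p2 t) ->
  has_density P mu1 Z1 p1 -> has_density P mu2 Z2 p2 -> independent P Z1 Z2 ->
  has_density P (mu1 \x mu2)%E (fun w => (Z1 w, Z2 w))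
    (fun t => p1 t.1 * p2 t.2).
Proof.
move=> mp1 mp2 p10 p20 d1E d2E ind A mA.
have mZ : measurable_fun setT (fun w => (Z1 w, Z2 w)).
  by apply/measurable_fun_pairP.
pose m : {measure set (T1 * T2) -> \bar R} :=
  measure_function_pushforward__canonical__measure_function_Measure P mZ.
transitivity ((distribution P Z1 \x distribution P Z2)%E A).
  symmetry; apply: (@product_measure_unique _ _ _ _ _ (distribution P Z1)
    (distribution P Z2) m); last exact: mA.
  by move=> B C mB mC; apply: ind.
pose p t := p1 t.1 * p2 t.2.
have mp : measurable_fun setT p.
  by apply: measurable_funM; apply: measurableT_comp.
have p0 t : 0 <= p t by exact: mulr_ge0.
transitivity (\int[distribution P Z1]_x distribution P Z2 (xsection A x))%E.
  by [].
rewrite ge0_integral_pushforward//; last exact: measurable_fun_xsection.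
rewrite preimage_setT [LHS](@ge0_integral_density _ _ _ _ _ _ mu1 Z1 p1 _ _ _ _
    (fun x => distribution P Z2 (xsection A x)))//;
  last exact: measurable_fun_xsection.
rewrite [RHS]integral_mkcond fubini_tonelli1; first last.
- by move=> x; rewrite patchE; case: ifP => // _; rewrite lee_fin; exact: p0.
- apply/(measurable_restrictT _ mA).
  exact/measurable_EFinP/measurable_funTS.
apply: eq_integral => x _; rewrite /fubini_F.
rewrite -[distribution P Z2 _]/(pushforward P Z2 (xsection A x)).
rewrite d2E; last exact: measurable_xsection.
rewrite -ge0_integralZr//; first last.
- by rewrite lee_fin.
- by move=> y _; rewrite lee_fin.
- exact/measurable_EFinP/measurable_funTS.
- exact: measurable_xsection.
rewrite integral_mkcond.
apply: eq_integral => y _; rewrite !patchE /= mem_xsection.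
by case: ifP => _ //; rewrite -EFinM mulrC.
Qed.

(** * Translations and shears of pairs of column vectors *)

Lemma measurable_shift2 {R : realType} N L (a : 'cV[R]_N * 'cV[R]_L) :
  measurable_fun setT
    (fun t : 'cV[R]_N * 'cV[R]_L => (t.1 + a.1, t.2 + a.2)).
Proof.
apply/measurable_fun_pairP; split => /=.
  exact: (measurableT_comp (measurable_addv _ a.1) measurable_fst).
exact: (measurableT_comp (measurable_addv _ a.2) measurable_snd).
Qed.

Lemma ge0_integral_lebesgue_cV2_shift {R : realType} N L
    (a : 'cV[R]_N * 'cV[R]_L) (f : 'cV[R]_N * 'cV[R]_L -> \bar R) :
  measurable_fun setT f -> (forall t, 0 <= f t)%E ->
  (\int[lebesgue_cV N \x lebesgue_cV L]_t f (t.1 + a.1, t.2 + a.2)%R =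
   \int[lebesgue_cV N \x lebesgue_cV L]_t f t)%E.
Proof.
move=> mf f0.
have mfa := measurableT_comp mf (measurable_shift2 N L a).
rewrite (fubini_tonelli1 _ mfa (fun t => f0 _)) (fubini_tonelli1 _ mf f0).
rewrite /fubini_F /=.
rewrite (ge0_integral_lebesgue_cV_shift _ a.1
  (fun x => \int[lebesgue_cV L]_y f (x, (y + a.2)%R)))%E; first last.
- by move=> x; exact: integral_ge0.
- apply: (@measurable_fun_fubini_tonelli_F _ _ _ _ _ (lebesgue_cV L)
    (fun t : 'cV[R]_N * 'cV[R]_L => f (t.1, (t.2 + a.2)%R))) => //.
  apply: (measurableT_comp mf); apply/measurable_fun_pairP; split => /=.
    exact: measurable_fst.
  exact: (measurableT_comp (measurable_addv _ a.2) measurable_snd).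
apply: eq_integral => x _.
rewrite (ge0_integral_lebesgue_cV_shift _ a.2 (fun y => f (x, y)))//.
exact: (measurableT_comp mf (measurable_pair1 x)).
Qed.

Lemma integral_lebesgue_cV2_shift {R : realType} N L
    (a : 'cV[R]_N * 'cV[R]_L) (f : 'cV[R]_N * 'cV[R]_L -> \bar R) :
  measurable_fun setT f ->
  (\int[lebesgue_cV N \x lebesgue_cV L]_t f (t.1 + a.1, t.2 + a.2)%R =
   \int[lebesgue_cV N \x lebesgue_cV L]_t f t)%E.
Proof.
move=> mf; rewrite [LHS]integralE [RHS]integralE; congr (_ - _)%E.
- rewrite -[RHS](ge0_integral_lebesgue_cV2_shift _ _ a)//; last first.
    exact: measurable_funepos.
  by apply: eq_integral => t _; rewrite !funeposE.
- rewrite -[RHS](ge0_integral_lebesgue_cV2_shift _ _ a)//; last first.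
    exact: measurable_funeneg.
  by apply: eq_integral => t _; rewrite !funenegE.
Qed.

(** The shear [(z1, z2) -> (phi z2 + z1, z2)] preserves Lebesgue measure because it is a translation
    at each fixed [z2]. This dictates the order of integration in Tonelli: the first coordinate is
    innermost. *)
Lemma has_density_add_pair d (Omega : measurableType d) {R : realType}
    (P : probability Omega R) N L (Z1 : Omega -> 'cV[R]_N)
    (Z2 : Omega -> 'cV[R]_L) (p : 'cV[R]_N * 'cV[R]_L -> R)
    (phi : 'cV[R]_L -> 'cV[R]_N) :
  measurable_fun setT Z1 -> measurable_fun setT Z2 ->
  measurable_fun setT p -> measurable_fun setT phi -> (forall t, 0 <= p t) ->
  has_density P (lebesgue_cV N \x lebesgue_cV L)%E
    (fun w => (Z1 w, Z2 w)) p ->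
  has_density P (lebesgue_cV N \x lebesgue_cV L)%E
    (fun w => (phi (Z2 w) + Z1 w, Z2 w))
    (fun t => p (t.1 - phi t.2, t.2)).
Proof.
move=> mZ1 mZ2 mp mphi p0 dZ A mA.
pose f (t : 'cV[R]_N * 'cV[R]_L) : \bar R := (\1_A (phi t.2 + t.1, t.2))%:E.
(* The scalar [s] serves twice: [1] for the shear and [-1] for its inverse. *)
have madd s : measurable_fun setT (fun t : 'cV[R]_N * 'cV[R]_L => s *: phi t.2 + t.1).
  apply/measurable_fun_cVP => i; under eq_fun do rewrite !mxE.
  apply: measurable_funD; last first.
    by move/measurable_fun_cVP: (@measurable_fst _ _ 'cV[R]_N 'cV[R]_L); apply.
  apply: measurable_funM => //.
  have /measurable_fun_cVP := measurableT_comp mphi (@measurable_snd _ _ 'cV[R]_N 'cV[R]_L).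
  exact.
have mshear s : measurable_fun setT
    (fun t : 'cV[R]_N * 'cV[R]_L => (s *: phi t.2 + t.1, t.2)).
  by apply/measurable_fun_pairP; split; [exact: madd|exact: measurable_snd].
have mZ : measurable_fun setT (fun w => (Z1 w, Z2 w)).
  by apply/measurable_fun_pairP.
have ms1 : measurable_fun setT
    (fun t : 'cV[R]_N * 'cV[R]_L => (phi t.2 + t.1, t.2)).
  by have := mshear 1; under eq_fun do rewrite scale1r.
have mf : measurable_fun setT f.
  exact/measurable_EFinP/(measurableT_comp (measurable_indic mA)).
transitivity (\int[P]_w f (Z1 w, Z2 w))%E.
  rewrite (_ : (fun w => f _) =
    fun w => (\1_((fun w => (phi (Z2 w) + Z1 w, Z2 w)) @^-1` A) w)%:E)//.
  rewrite integral_indic ?setIT// -[X in measurable X]setTI.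
  exact: (measurableT_comp ms1 mZ).
rewrite (@ge0_integral_density _ _ _ P _ _ (lebesgue_cV N \x lebesgue_cV L)%E
  (fun w => (Z1 w, Z2 w)) p mZ mp p0 dZ f mf); last first.
  by move=> t; rewrite lee_fin.
have mf' : measurable_fun setT (fun t => f t * (p t)%:E)%E.
  by apply: emeasurable_funM => //; exact/measurable_EFinP.
have f'0 t : (0 <= f t * (p t)%:E)%E by rewrite mule_ge0// lee_fin.
have mg : measurable_fun setT
    (fun t : 'cV[R]_N * 'cV[R]_L => p (t.1 - phi t.2, t.2)).
  have := measurableT_comp mp (mshear (-1)).
  by under eq_fun do rewrite /= scaleN1r addrC.
rewrite (fubini_tonelli2 _ mf' f'0) [RHS]integral_mkcond [RHS]fubini_tonelli2;
  first last.
- by move=> x; rewrite patchE; case: ifP => // _; rewrite lee_fin.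
- apply/(measurable_restrictT _ mA).
  exact/measurable_EFinP/measurable_funTS.
apply: eq_integral => x _; rewrite /fubini_G.
rewrite -[LHS](ge0_integral_lebesgue_cV_shift _ (- phi x)
  (fun y => f (y, x) * (p (y, x))%:E)%E)//; last first.
  exact: (measurableT_comp mf' (measurable_pair2 x)).
apply: eq_integral => y _; rewrite patchE /f /= indicE addrC subrK.
by case: ifP => _; rewrite ?mul1e ?mul0e.
Qed.

(** Here [r] is the likelihood ratio of the translated law. The identity holds between extended
    reals for a signed [f], because positive and negative parts are transformed separately. *)
Lemma integral_density_shift d (Omega : measurableType d) {R : realType}
    (P : probability Omega R) N L (Z : Omega -> 'cV[R]_N * 'cV[R]_L)
    (p r : 'cV[R]_N * 'cV[R]_L -> R) (a : 'cV[R]_N * 'cV[R]_L)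
    (f : 'cV[R]_N * 'cV[R]_L -> R) :
  measurable_fun setT Z -> measurable_fun setT p -> measurable_fun setT r ->
  measurable_fun setT f -> (forall t, 0 <= p t) ->
  has_density P (lebesgue_cV N \x lebesgue_cV L)%E Z p ->
  (forall t : 'cV[R]_N * 'cV[R]_L, p (t.1 + a.1, t.2 + a.2) = r t * p t) ->
  (\int[P]_w (f (Z w) * r (Z w))%:E =
   \int[P]_w (f ((Z w).1 - a.1, (Z w).2 - a.2)%R)%:E)%E.
Proof.
move=> mZ mp mr mf p0 dZ pE.
have mfa : measurable_fun setT (fun t : 'cV[R]_N * 'cV[R]_L => f (t.1 - a.1, t.2 - a.2)).
  exact: (measurableT_comp mf (measurable_shift2 N L (- a.1, - a.2))).
have mfr : measurable_fun setT (fun t => f t * r t) by exact: measurable_funM.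
rewrite (@integral_density _ _ _ _ _ _ (lebesgue_cV N \x lebesgue_cV L)%E
  Z p _ _ _ _ (fun t => (f t * r t)%:E))//; last exact/measurable_EFinP.
rewrite (@integral_density _ _ _ _ _ _ (lebesgue_cV N \x lebesgue_cV L)%E
  Z p _ _ _ _ (fun t => (f (t.1 - a.1, t.2 - a.2)%R)%:E))//;
  last exact/measurable_EFinP.
rewrite -[RHS](integral_lebesgue_cV2_shift _ _ a).
  by apply: eq_integral => -[y x] _; rewrite /= !addrK -!EFinM (pE (y, x)) mulrA.
by apply: emeasurable_funM; exact/measurable_EFinP.
Qed.

(** * Square-integrable random variables *)

Section square_integrable.
Context d (Omega : measurableType d) (R : realType) (P : probability Omega R).
Implicit Types f g : Omega -> R.

(** Measurability is a separate conjunct because that of the square does not imply that of the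
    function. *)
Definition sqr_integrable (f : Omega -> R) : Prop :=
  measurable_fun setT f /\ P.-integrable setT (fun w => (f w ^+ 2)%:E).

Lemma integrable_le f g : measurable_fun setT f ->
  P.-integrable setT (EFin \o g) -> (forall w, `|f w| <= g w) ->
  P.-integrable setT (EFin \o f).
Proof.
move=> mf ig fg; apply: (le_integrable _ _ _ ig) => //.
  exact/measurable_EFinP.
by move=> w _; rewrite /= lee_fin (le_trans (fg w))// ler_norm.
Qed.

Lemma sqr_integrable_le f g : measurable_fun setT f -> sqr_integrable g ->
  (forall w, `|f w| <= g w) -> sqr_integrable f.
Proof.
move=> mf [mg ig] fg; split => //.
apply: (integrable_le (fun w => f w ^+ 2) _ _ ig); first exact: measurable_funX.
move=> w; rewrite normrX ler_sqr ?nnegrE//.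
exact: le_trans (fg w).
Qed.

Lemma sqr_integrable_cst (c : R) : sqr_integrable (cst c).
Proof. by split => //; exact: (finite_measure_integrable_cst P (c ^+ 2)). Qed.

Lemma sqr_integrableM f g : sqr_integrable f -> sqr_integrable g ->
  P.-integrable setT (EFin \o (fun w => f w * g w)).
Proof.
move=> [mf f2] [mg g2].
apply: (integrable_le _ (fun w => f w ^+ 2 + g w ^+ 2)).
- exact: measurable_funM.
- by under [X in integrable _ _ X]eq_fun do rewrite /= EFinD; exact: integrableD.
- move=> w; rewrite normrM -(real_normK (num_real (f w))).
  rewrite -(real_normK (num_real (g w))).
  have := sqr_ge0 (`|f w| - `|g w|); have := normr_ge0 (f w).
  have := normr_ge0 (g w); nra.
Qed.

Lemma sqr_integrableW f : sqr_integrable f -> P.-integrable setT (EFin \o f).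
Proof.
move=> sf; have := sqr_integrableM _ _ sf (sqr_integrable_cst 1).
by under [X in integrable _ _ X -> _]eq_fun do rewrite /= mulr1.
Qed.

Lemma sqr_integrableZ (c : R) f : sqr_integrable f ->
  sqr_integrable (fun w => c * f w).
Proof.
move=> [mf f2]; split; first exact: measurable_funM.
by under [X in integrable _ _ X]eq_fun do rewrite exprMn EFinM; exact: integrableZl.
Qed.

Lemma sqr_integrableD f g : sqr_integrable f -> sqr_integrable g ->
  sqr_integrable (fun w => f w + g w).
Proof.
move=> [mf f2] [mg g2]; split; first exact: measurable_funD.
apply: (integrable_le (fun w => (f w + g w) ^+ 2)
  (fun w => 2 * (f w ^+ 2 + g w ^+ 2))).
- by apply: measurable_funX; exact: measurable_funD.
- under [X in integrable _ _ X]eq_fun do rewrite /= EFinM EFinD.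
  exact: (integrableZl measurableT 2 (integrableD measurableT f2 g2)).
- by move=> w; rewrite ger0_norm ?sqr_ge0//; have := sqr_ge0 (f w - g w); nra.
Qed.

Lemma sqr_integrableB f g : sqr_integrable f -> sqr_integrable g ->
  sqr_integrable (fun w => f w - g w).
Proof.
move=> sf sg; under eq_fun do rewrite -mulN1r.
by apply: sqr_integrableD => //; exact: sqr_integrableZ.
Qed.

Lemma sqr_integrable_sum I (r : seq I) (f : I -> Omega -> R) :
  (forall i, sqr_integrable (f i)) ->
  sqr_integrable (fun w => \sum_(i <- r) f i w).
Proof.
move=> sf; elim: r => [|i r IH].
  by under eq_fun do rewrite big_nil; exact: sqr_integrable_cst.
by under eq_fun do rewrite big_cons; exact: sqr_integrableD.
Qed.

Lemma integral_cst_prob (c : R) : (\int[P]_w c%:E = c%:E)%E.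
Proof.
rewrite -[LHS]/(\int[P]_w (cst c%:E w))%E integral_cst//.
by rewrite -[RHS]mule1; congr (_ * _)%E; exact: probability_setT.
Qed.

Lemma Rintegral_cst_prob (c : R) : \int[P]_w c = c.
Proof. by rewrite /Rintegral integral_cst_prob. Qed.

Lemma RintegralZ_prob (c : R) f : P.-integrable setT (EFin \o f) ->
  \int[P]_w (c * f w) = c * \int[P]_w f w.
Proof. by move=> fi; rewrite RintegralZl. Qed.

Lemma integrable_sum_fun I (r : seq I) (f : I -> Omega -> R) :
  (forall i, P.-integrable setT (EFin \o f i)) ->
  P.-integrable setT (EFin \o (fun w => \sum_(i <- r) f i w)).
Proof.
move=> fi; elim: r => [|i r IH].
  under [X in integrable _ _ X]eq_fun do rewrite /= big_nil.
  exact: (finite_measure_integrable_cst P 0).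
under [X in integrable _ _ X]eq_fun do rewrite /= big_cons EFinD.
exact: (integrableD measurableT (fi i) IH).
Qed.

Lemma Rintegral_sum_fun I (r : seq I) (f : I -> Omega -> R) :
  (forall i, P.-integrable setT (EFin \o f i)) ->
  \int[P]_w (\sum_(i <- r) f i w) = \sum_(i <- r) \int[P]_w f i w.
Proof.
move=> fi; elim: r => [|i r IH].
  under eq_Rintegral do rewrite big_nil.
  by rewrite big_nil Rintegral_cst_prob.
rewrite big_cons -IH -RintegralD//; last exact: integrable_sum_fun.
by apply: eq_Rintegral => w _; rewrite big_cons.
Qed.

(* An L2 version of differentiation under the integral sign, for a family
   [r n] of likelihood ratios that tends to 1 with derivative [s]. *)
Lemma Rintegral_score (F D s : Omega -> R) (r : nat -> Omega -> R)
    (h k : nat -> R) (l : R) :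
  sqr_integrable F -> sqr_integrable D -> measurable_fun setT s ->
  (forall n, measurable_fun setT (r n)) -> (forall n, 0 < h n) ->
  (forall n w, `|r n w - 1| <= h n * D w) ->
  (forall w, (h n)^-1 * (r n w - 1) @[n --> \oo] --> s w) ->
  (forall n, \int[P]_w (F w * r n w)%:E =
    \int[P]_w (F w)%:E + (h n * k n)%:E)%E ->
  k n @[n --> \oo] --> l ->
  P.-integrable setT (EFin \o (fun w => F w * s w)) /\
  \int[P]_w (F w * s w) = l.
Proof.
move=> sF sD ms mr h0 rD rs Er kl.
pose f n w := F w * ((h n)^-1 * (r n w - 1)).
have mF : measurable_fun setT F by case: sF.
have mf n : measurable_fun setT (f n).
  by apply: measurable_funM => //; apply: measurable_funM => //; exact: measurable_funB.
(* The dominating function does not depend on [n], and it is integrable as a product of two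
   square-integrable functions. *)
pose g w := `|F w| * D w.
have ig : P.-integrable setT (EFin \o g).
  apply: sqr_integrableM => //; split; first exact: measurableT_comp.
  by under [X in integrable _ _ X]eq_fun do rewrite real_normK ?num_real//; case: sF.
have fg n w : `|f n w| <= g w.
  rewrite /f /g normrM ler_wpM2l// normrM gtr0_norm ?invr_gt0//.
  by rewrite ler_pdivrMl.
have := @dominated_convergence _ _ _ P setT measurableT
  (fun n => EFin \o f n) (fun w => (F w * s w)%:E) (EFin \o g).
case.
- by move=> n; exact/measurable_EFinP.
- exact/measurable_EFinP/measurable_funM.
- apply: aeW => w _ /=; apply: cvg_EFin; first exact: nearW.
  by apply: cvgM; [exact: cvg_cst|exact: rs].
- by [].
- by apply: aeW => w n _; rewrite /= lee_fin.
move=> iFs _ cvgf; split => //.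
(* The expectation of [F] is finite, so it cancels from both sides of [Er], and [h n] can be divided
   out: the integral of the quotient is exactly [k n]. *)
have fE n : (\int[P]_w (f n w)%:E = (k n)%:E)%E.
  have ifn : P.-integrable setT (EFin \o f n) by exact: integrable_le (fg n).
  have iF : P.-integrable setT (EFin \o F) by exact: sqr_integrableW.
  have := Er n.
  have -> : (\int[P]_w (F w * r n w)%:E =
      \int[P]_w (F w)%:E + (h n)%:E * \int[P]_w (f n w)%:E)%E.
    rewrite -integralZl// -integralD//; last exact: integrableZl.
    apply: eq_integral => w _; rewrite /f /= -EFinM -EFinD; congr EFin.
    by field; rewrite gt_eqF.
  have /fineK <- := integrable_fin_num measurableT iF.
  have /fineK <- := integrable_fin_num measurableT ifn.
  rewrite -!EFinM -!EFinD => -[] /addrI/mulfI -> //.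
  by rewrite gt_eqF.
suff e : (\int[P]_w (F w * s w)%:E = l%:E)%E by rewrite /Rintegral e.
apply: (cvg_unique _ cvgf) => //.
rewrite (_ : [sequence _]_n = fun n => (k n)%:E); last by apply/funext => n; exact: fE.
by apply: cvg_EFin; first exact: nearW.
Qed.

End square_integrable.

Arguments sqr_integrable {d Omega R} P f.

(** * Diagonal Gaussian densities *)

Lemma invmx_diag_mx {F : fieldType} n (s : 'rV[F]_n) :
  (forall i, s 0 i != 0) ->
  diag_mx s \in unitmx /\ invmx (diag_mx s) = diag_mx (\row_i (s 0 i)^-1).
Proof.
move=> s0; have ds : diag_mx s *m diag_mx (\row_i (s 0 i)^-1) = 1%:M.
  rewrite mul_diag_mx; apply/matrixP => i j; rewrite !mxE.
  by case: eqVneq => [->|_]; rewrite ?mulr1n ?mulfV// !mulr0n mulr0.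
have [us _] := mulmx1_unit ds; split => //.
by rewrite -[RHS]mul1mx -(mulVmx us) -mulmxA ds mulmx1.
Qed.

Lemma gaussian_pdf_diag {R : realType} n (m : 'cV[R]_n) (s : 'rV[R]_n) v :
  (forall i, s 0 i != 0) ->
  gaussian_pdf m (diag_mx s) v = (Num.sqrt ((2 * pi) ^+ n * \prod_i s 0 i))^-1 *
    expR (- (\sum_i (v i 0 - m i 0) ^+ 2 / s 0 i) / 2).
Proof.
move=> s0; rewrite /gaussian_pdf det_diag (invmx_diag_mx _ _ s0).2.
congr (_ * expR (- _ / 2)); rewrite mul_mx_diag mxE; apply: eq_bigr => i _.
by rewrite !mxE mulrAC -expr2.
Qed.

Lemma measurable_gaussian_pdf_diag {R : realType} n (s : 'rV[R]_n) :
  (forall i, s 0 i != 0) ->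
  measurable_fun setT (gaussian_pdf (0 : 'cV[R]_n) (diag_mx s)).
Proof.
move=> s0.
rewrite (_ : gaussian_pdf _ _ = fun v : 'cV[R]_n =>
  (Num.sqrt ((2 * pi) ^+ n * \prod_i s 0 i))^-1 *
    expR (- (\sum_i (v i 0 - (0 : 'cV[R]_n) i 0) ^+ 2 / s 0 i) / 2)); last first.
  by apply/funext => v; exact: gaussian_pdf_diag.
apply: measurable_funM => //; apply: measurableT_comp => //.
apply: measurable_funM => //; apply: measurableT_comp => //.
apply: measurable_sum => i; apply: measurable_funM => //.
apply: measurable_funX; apply: measurable_funB => //.
exact: measurable_coord.
Qed.

Lemma gaussian_pdf_ge0 {R : realType} n (m : 'cV[R]_n) S v :
  0 <= gaussian_pdf m S v.
Proof. by rewrite mulr_ge0 ?expR_ge0// invr_ge0 sqrtr_ge0. Qed.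

(** * Difference quotients along a sequence and exponential estimates *)

Lemma cvg_slope_harmonic {R : realType} (g : R -> R) (l : R) :
  is_derive (0 : R) 1 g l ->
  (harmonic n)^-1 * (g (harmonic n) - g 0) @[n --> \oo] --> l.
Proof.
move=> [dg <-].
(* Dominated convergence is applied to sequences, so the punctured limit is specialised to
   [1/(n+1)], which tends to 0 without vanishing. *)
have /cvgr_dnbhsP h : (h^-1 *: (g (h *: 1 + 0) - g 0) @[h --> 0^']) --> 'D_1 g 0.
  exact: dg.
rewrite (_ : (fun n => _) = fun n => (harmonic n)^-1 *:
  (g (harmonic n *: 1 + 0) - g 0)); last first.
  by apply/funext => n; rewrite addr0 [_ *: 1]mulr1.
apply: h; split; last exact: cvg_harmonic.
by move=> n; rewrite gt_eqF ?harmonic_gt0.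
Qed.

Lemma is_derive_expR_poly {R : realType} (p : {poly R}) (x : R) :
  is_derive x 1 (fun h => expR p.[h]) (expR p.[x] * p^`().[x]).
Proof. exact: (is_derive1_comp (is_derive_expR _) (is_derive_poly _ _)). Qed.

(** Both signs follow from [1 + t <= expR t]. For [w >= 0] take [t = - w] and multiply by [expR w];
    for [w < 0] the choice [t = w] already bounds the left side by [- w]. *)
Lemma expR_sub1_le {R : realType} (w : R) : `|expR w - 1| <= `|w| * expR `|w|.
Proof.
have E1 : (1 <= expR w) = (0 <= w) by rewrite -{1}expR0 ler_expR.
have EN1 : expR w * expR (- w) = 1 by rewrite -expRD subrr expR0.
have E0 := expR_gt0 w; have EN0 := expR_gt0 (- w).
have := expR_ge1Dx w; have := expR_ge1Dx (- w).
have [w0|w0] := leP 0 w.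
  rewrite (ger0_norm w0) ger0_norm ?subr_ge0 ?E1//; nra.
have w1 : expR w <= 1 by rewrite -expR0 ler_expR ltW.
by rewrite (ltr0_norm w0) ler0_norm ?subr_le0//; nra.
Qed.

Lemma expR_norm_le {R : realType} (x : R) : expR `|x| <= expR x + expR (- x).
Proof.
have := expR_gt0 x; have := expR_gt0 (- x).
by case: (leP 0 x) => x0; [rewrite ger0_norm//|rewrite ltr0_norm//]; lra.
Qed.

(** * Moments of the noise and of the random parameter *)

Section gaussian_model.
Context (R : realType) (N L : nat) (sigma2 : R) (sigma2_gt0 : 0 < sigma2).
Local Notation T := ('cV[R]_N * 'cV[R]_L)%type.

(* The inner product of the precision matrix of (noise, x). *)
Definition precision_ip (g : 'cV[R]_L) (z z' : T) : R :=
  (\sum_i z.1 i 0 * z'.1 i 0) / sigma2 + \sum_k z.2 k 0 * z'.2 k 0 / g k 0.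

Definition noise_x_pdf (g : 'cV[R]_L) (z : T) : R :=
  gaussian_pdf 0 sigma2%:M z.1 * gaussian_pdf 0 (Upsilon g) z.2.

Let s2_neq0 n (i : 'I_n) : (const_mx sigma2 : 'rV[R]_n) 0 i != 0.
Proof. by rewrite mxE gt_eqF. Qed.

Let g_neq0 (g : 'cV[R]_L) : positive_cV g -> forall i, g^T 0 i != 0.
Proof. by move=> g0 i; rewrite mxE gt_eqF// g0. Qed.

Lemma noise_x_pdf_ge0 g (z : T) : 0 <= noise_x_pdf g z.
Proof. by rewrite mulr_ge0 ?gaussian_pdf_ge0. Qed.

Lemma noise_x_pdfE g z : positive_cV g -> noise_x_pdf g z =
  (Num.sqrt ((2 * pi) ^+ N * sigma2 ^+ N))^-1 *
  (Num.sqrt ((2 * pi) ^+ L * \prod_i g i 0))^-1 *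
  expR (- precision_ip g z z / 2).
Proof.
move=> g0; rewrite /noise_x_pdf -diag_const_mx !gaussian_pdf_diag//; last exact: g_neq0.
rewrite mulrACA -expRD; congr ((Num.sqrt (_ * _))^-1 * (Num.sqrt (_ * _))^-1 * expR _).
- by under eq_bigr do rewrite mxE; rewrite big_const_ord iter_mulr_1.
- by under eq_bigr do rewrite mxE.
- rewrite /precision_ip mulr_suml.
  rewrite -mulrDl -opprD; congr (- (_ + _) / 2); apply: eq_bigr => i _;
    by rewrite !mxE subr0 expr2.
Qed.

Lemma measurable_noise_x_pdf g : positive_cV g -> measurable_fun setT (noise_x_pdf g).
Proof.
move=> g0; apply: measurable_funM.
  apply: (measurableT_comp _ measurable_fst).
  by rewrite -diag_const_mx; exact: measurable_gaussian_pdf_diag.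
apply: (measurableT_comp _ measurable_snd).
by apply: measurable_gaussian_pdf_diag; exact: g_neq0.
Qed.

Lemma precision_ipZr g (h : R) (z v : T) :
  precision_ip g z (h *: v.1, h *: v.2) = h * precision_ip g z v.
Proof.
rewrite /precision_ip /= mulrDr mulrA; congr (_ / _ + _).
  by rewrite mulr_sumr; apply: eq_bigr => i _; rewrite mxE mulrCA.
by rewrite mulr_sumr; apply: eq_bigr => i _; rewrite mxE mulrCA !mulrA.
Qed.

Lemma precision_ipDr g (z u a : T) :
  precision_ip g z (u.1 + a.1, u.2 + a.2) =
  precision_ip g z u + precision_ip g z a.
Proof.
rewrite /precision_ip /= addrACA -mulrDl -!big_split.
by congr (_ / _ + _); apply: eq_bigr => i _; rewrite !mxE ?mulrDr ?mulrDl.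
Qed.

Lemma precision_ipC g (z z' : T) : precision_ip g z z' = precision_ip g z' z.
Proof.
by rewrite /precision_ip; congr (_ / _ + _); apply: eq_bigr => i _; rewrite [_ i 0 * _]mulrC.
Qed.

Lemma precision_ipDD g (z a : T) :
  precision_ip g (z.1 + a.1, z.2 + a.2) (z.1 + a.1, z.2 + a.2) =
  precision_ip g z z + 2 * precision_ip g z a + precision_ip g a a.
Proof.
rewrite precision_ipDr ![precision_ip g (_, _) _]precision_ipC !precision_ipDr.
by rewrite [precision_ip g a z]precision_ipC; ring.
Qed.

Lemma precision_ip_ge0 g (z : T) : positive_cV g -> 0 <= precision_ip g z z.
Proof.
move=> g0; rewrite addr_ge0//.
  rewrite divr_ge0// ?(ltW sigma2_gt0)//.
  by apply: sumr_ge0 => i _; rewrite -expr2 sqr_ge0.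
by apply: sumr_ge0 => i _; rewrite divr_ge0 ?(ltW (g0 _))// -expr2 sqr_ge0.
Qed.

Lemma measurable_precision_ip g (v : T) :
  measurable_fun setT (fun z : T => precision_ip g z v).
Proof.
apply: measurable_funD.
  apply: measurable_funM => //; apply: measurable_sum => i.
  apply: measurable_funM => //.
  exact: (measurableT_comp (measurable_coord i) measurable_fst).
apply: measurable_sum => i; apply: measurable_funM => //.
apply: measurable_funM => //.
exact: (measurableT_comp (measurable_coord i) measurable_snd).
Qed.

(** Expanding the quadratic form of the shifted point leaves a cross term and a constant in the
    exponent; the normalising factors are the same on both sides. *)
Lemma noise_x_pdf_shift g (h : R) (v z : T) : positive_cV g ->
  noise_x_pdf g (z.1 + h *: v.1, z.2 + h *: v.2) =
  expR (- (h * precision_ip g z v + h ^+ 2 * precision_ip g v v / 2)) *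
  noise_x_pdf g z.
Proof.
move=> g0; rewrite !noise_x_pdfE// mulrCA -expRD; congr (_ * expR _).
have := precision_ipDD g z (h *: v.1, h *: v.2); rewrite /= => ->.
rewrite !precision_ipZr [precision_ip g (_, _) v]precision_ipC precision_ipZr.
by field.
Qed.

Context d (Omega : measurableType d) (P : 'cV[R]_L -> probability Omega R).
Context (X : {mfun Omega >-> 'cV[R]_L}) (noise : {mfun Omega >-> 'cV[R]_N}).
Hypothesis X_gaussian : forall g, positive_cV g -> gaussian (P g) X 0 (Upsilon g).
Hypothesis noise_gaussian : forall g, positive_cV g ->
  gaussian (P g) noise 0 sigma2%:M.
Hypothesis X_noise_independent : forall g, positive_cV g ->
  independent (P g) X noise.

Definition noise_x (w : Omega) : T := (noise w, X w).

Lemma measurable_noise_x : measurable_fun setT noise_x.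
Proof. exact/measurable_fun_pairP. Qed.

Lemma has_density_noise_x g : positive_cV g ->
  has_density (P g) (lebesgue_cV N \x lebesgue_cV L)%E noise_x (noise_x_pdf g).
Proof.
move=> g0; apply: has_density_pair.
- by rewrite -diag_const_mx; exact: measurable_gaussian_pdf_diag.
- by apply: measurable_gaussian_pdf_diag; exact: g_neq0.
- by move=> t; exact: gaussian_pdf_ge0.
- by move=> t; exact: gaussian_pdf_ge0.
- exact: noise_gaussian.
- exact: X_gaussian.
- by move=> A B mA mB; rewrite setIC muleC; exact: X_noise_independent.
Qed.

(* The Cameron-Martin formula. *)
Lemma integral_noise_x_shift g (f : T -> R) (h : R) (v : T) : positive_cV g ->
  measurable_fun setT f ->
  (\int[P g]_w (f (noise_x w) * expR (- (h * precision_ip g (noise_x w) v +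
     h ^+ 2 * precision_ip g v v / 2)))%:E =
   \int[P g]_w (f ((noise_x w).1 - h *: v.1, (noise_x w).2 - h *: v.2)%R)%:E)%E.
Proof.
move=> g0 mf.
apply: (integral_density_shift _ _ _ _ _ noise_x (noise_x_pdf g)
  (fun z => expR (- (h * precision_ip g z v + h ^+ 2 * precision_ip g v v / 2)))
  (h *: v.1, h *: v.2)) => //.
- exact: measurable_noise_x.
- exact: measurable_noise_x_pdf.
- apply: measurableT_comp => //; apply: measurableT_comp => //.
  apply: measurable_funD => //; apply: measurable_funM => //.
  exact: measurable_precision_ip.
- exact: noise_x_pdf_ge0.
- exact: has_density_noise_x.
- by move=> z; exact: noise_x_pdf_shift.
Qed.

Lemma measurable_precision_ip_noise_x g (v : T) :
  measurable_fun setT (fun w => precision_ip g (noise_x w) v).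
Proof.
exact: (measurableT_comp (measurable_precision_ip g v) measurable_noise_x).
Qed.

(** The Cameron-Martin formula for the constant 1 says that the likelihood ratio has expectation 1.
    With [h = - 2 c] this ratio is the squared exponential up to the constant factor [expR (- k)],
    so integrability comes without any Gaussian integral. *)
Lemma sqr_integrable_expR_precision_ip g (c : R) (v : T) : positive_cV g ->
  sqr_integrable (P g) (fun w => expR (c * precision_ip g (noise_x w) v)).
Proof.
move=> g0; have mb := measurable_precision_ip_noise_x g v.
have mE b : measurable_fun setT (fun w => expR (b * precision_ip g (noise_x w) v)).
  by apply: measurableT_comp => //; exact: measurable_funM.
split => //.
under [X in integrable _ _ X]eq_fun do rewrite -expRM_natl mulrA.
set h := - (2%:R * c).
have I1 : (\int[P g]_w (1 * expR (- (h * precision_ip g (noise_x w) v +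
     h ^+ 2 * precision_ip g v v / 2)))%:E = 1)%E.
  rewrite (integral_noise_x_shift g (cst 1) h v g0 (measurable_cst _)).
  rewrite -[LHS]/(\int[P g]_w (cst 1%E w))%E integral_cst//.
  by rewrite mul1e; exact: probability_setT.
set k := h ^+ 2 * precision_ip g v v / 2.
have iE : (P g).-integrable setT
    (fun w => (expR (- (h * precision_ip g (noise_x w) v + k)))%:E).
  apply/integrableP; split.
    apply/measurable_EFinP/measurableT_comp => //; apply: measurableT_comp => //.
    by apply: measurable_funD => //; exact: measurable_funM.
  have -> : (\int[P g]_w `|(expR (- (h * precision_ip g (noise_x w) v + k)))%:E| = 1)%E.
    rewrite -[RHS]I1; apply: eq_integral => w _.
    by rewrite /= ger0_norm ?expR_ge0// mul1r.
  exact: ltry.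
have := integrableZl measurableT (expR k) iE.
congr (integrable _ _ _); apply/funext => w.
by rewrite -EFinM -expRD /h; congr (expR _)%:E; ring.
Qed.

Lemma sqr_integrable_expR_norm_precision_ip g (c : R) (v : T) : positive_cV g ->
  sqr_integrable (P g) (fun w => expR `|c * precision_ip g (noise_x w) v|).
Proof.
move=> g0; have mb := measurable_precision_ip_noise_x g v.
apply: (@sqr_integrable_le _ _ _ _ _ (fun w =>
  expR (c * precision_ip g (noise_x w) v) +
  expR (- c * precision_ip g (noise_x w) v))).
- apply: measurableT_comp => //; apply: measurableT_comp => //.
  exact: measurable_funM.
- by apply: sqr_integrableD; exact: sqr_integrable_expR_precision_ip.
- by move=> w; rewrite ger0_norm ?expR_ge0// mulNr; exact: expR_norm_le.
Qed.

(** Polynomial moments are bounded by exponential ones, through [t <= expR t]. *)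
Lemma sqr_integrable_precision_ip g (v : T) : positive_cV g ->
  sqr_integrable (P g) (fun w => precision_ip g (noise_x w) v).
Proof.
move=> g0.
apply: (@sqr_integrable_le _ _ _ _ _ (fun w =>
  expR `|1 * precision_ip g (noise_x w) v|)).
- exact: measurable_precision_ip_noise_x.
- exact: sqr_integrable_expR_norm_precision_ip.
- by move=> w; rewrite mul1r; have := expR_ge1Dx `|precision_ip g (noise_x w) v|; lra.
Qed.

Lemma sqr_integrable_precision_ip2 g (v : T) : positive_cV g ->
  sqr_integrable (P g) (fun w => precision_ip g (noise_x w) v ^+ 2).
Proof.
move=> g0.
apply: (@sqr_integrable_le _ _ _ _ _ (fun w =>
  expR `|2 * precision_ip g (noise_x w) v|)).
- by apply: measurable_funX; exact: measurable_precision_ip_noise_x.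
- exact: sqr_integrable_expR_norm_precision_ip.
- move=> w; rewrite normrX normrM (ger0_norm (ler0n R 2)) expRM_natl ler_sqr ?nnegrE ?expR_ge0//.
  by have := expR_ge1Dx `|precision_ip g (noise_x w) v|; lra.
Qed.

(* Stein's identity for functions that are affine in the direction [v]. *)
Lemma Rintegral_precision_ip g (f : T -> R) (k : R) (v : T) : positive_cV g ->
  measurable_fun setT f -> sqr_integrable (P g) (fun w => f (noise_x w)) ->
  (forall h z, f (z.1 - h *: v.1, z.2 - h *: v.2) = f z - h * k) ->
  \int[P g]_w (f (noise_x w) * precision_ip g (noise_x w) v) = k.
Proof.
move=> g0 mf sf fk.
pose b w := precision_ip g (noise_x w) v; pose c := precision_ip g v v.
have c0 : 0 <= c by exact: precision_ip_ge0.
(* For a step [h <= 1] the exponent is at most [h (|b| + c)] in absolute value. By [expR_sub1_le]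
   the ratio then differs from 1 by at most [h (|b| + c) expR (|b| + c)], and [t <= expR t] turns
   this into [h expR (2 (|b| + c))]. *)
pose D w := expR (2 * c) * expR `|2 * b w|.
pose r n w := expR (- (harmonic n * b w + harmonic n ^+ 2 * c / 2)).
have mb : measurable_fun setT b by exact: measurable_precision_ip_noise_x.
(* The ratio [r n] has derivative [- b] at step 0, which explains the two signs. *)
have [_] : (P g).-integrable setT (EFin \o (fun w => f (noise_x w) * (- b w))) /\
    \int[P g]_w (f (noise_x w) * (- b w)) = - k.
  apply: (Rintegral_score _ _ _ (P g) _ D _ r harmonic (cst (- k))) => //.
  - by apply: sqr_integrableZ; exact: sqr_integrable_expR_norm_precision_ip.
  - exact: measurableT_comp.
  - move=> n; apply: measurableT_comp => //; apply: measurableT_comp => //.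
    by apply: measurable_funD => //; exact: measurable_funM.
  - by move=> n; exact: harmonic_gt0.
  - move=> n w; rewrite /r; set x := - _.
    have h0 := @harmonic_gt0 R n; have h1 : (harmonic n : R) <= 1.
      by rewrite invf_le1 ?ler1n.
    have xle : `|x| <= harmonic n * (`|b w| + c).
      rewrite normrN; apply: (le_trans (ler_normD _ _)); rewrite (mulrDr (harmonic n) `|b w| c).
      apply: lerD; first by rewrite normrM (gtr0_norm h0).
      rewrite ger0_norm; last by rewrite divr_ge0// mulr_ge0// sqr_ge0.
      have : 0 <= harmonic n * (1 - harmonic n) * c.
        by rewrite !mulr_ge0 ?subr_ge0// ltW.
      have : 0 <= harmonic n * c by rewrite mulr_ge0// ltW.
      by lra.
    apply: (le_trans (expR_sub1_le x)).
    have xle' : `|x| <= `|b w| + c.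
      by apply: (le_trans xle); rewrite ler_piMl// addr_ge0.
    rewrite /D -expRD normrM (ger0_norm (ler0n _ 2)).
    apply: (@le_trans _ _ (harmonic n * (`|b w| + c) * expR (`|b w| + c))).
      by apply: ler_pM => //; rewrite ler_expR.
    rewrite -mulrA ler_pM2l//.
    rewrite (_ : 2 * c + 2 * `|b w| = (`|b w| + c) + (`|b w| + c)); last by ring.
    rewrite (expRD (`|b w| + c)) ler_wpM2r ?expR_ge0//.
    by have := expR_ge1Dx (`|b w| + c); lra.
  - move=> w; pose G (h : R) := expR (- (h * b w + h ^+ 2 * c / 2)).
    have -> : (fun n => (harmonic n)^-1 * (r n w - 1)) =
        fun n => (harmonic n)^-1 * (G (harmonic n) - G 0).
      by apply/funext => n; rewrite /G !mul0r expr0n/= !mul0r addr0 oppr0 expR0.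
    apply: cvg_slope_harmonic.
    pose p : {poly R} := - (b w *: 'X + (c / 2) *: 'X^2).
    have -> : G = fun h => expR p.[h].
      by apply/funext => h; rewrite /G /p hornerN hornerD !hornerZ hornerX hornerXn;
        congr expR; ring.
    apply: (@is_derive_eq _ _ _ _ _ _ _ _ (is_derive_expR_poly p 0)).
    have -> : p.[0] = 0.
      by rewrite /p hornerN hornerD !hornerZ hornerX hornerXn expr0n !mulr0 addr0 oppr0.
    have -> : p^`() = - (b w *: 1 + (c / 2) *: ('X *+ 2)).
      by rewrite /p derivN derivD !derivZ derivX derivXn.
    rewrite hornerN hornerD !hornerZ hornerMn hornerX hornerC mul0rn.
    by rewrite expR0 mulr0 addr0 mulr1 mul1r.
  (* By Cameron-Martin the ratio moves into the argument of [f], where it subtracts [h k]; the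
     difference quotient of the expectations is the constant [- k]. *)
  - move=> n; rewrite integral_noise_x_shift//.
    transitivity (\int[P g]_w ((f (noise_x w))%:E +
      (cst (harmonic n * - k) w)%:E))%E.
      by apply: eq_integral => w _; rewrite fk mulrN EFinD.
    rewrite integralD//; first by rewrite integral_cst_prob.
    + exact: sqr_integrableW.
    + exact: (finite_measure_integrable_cst (P g) (harmonic n * - k)).
  - exact: cvg_cst.
under eq_Rintegral do rewrite mulrN -mulN1r.
rewrite RintegralZ_prob; last first.
  by apply: sqr_integrableM => //; exact: sqr_integrable_precision_ip.
by rewrite mulN1r => /oppr_inj.
Qed.

(** * Moments of x and of the linear forms [precision_ip] *)

Lemma precision_ip_delta g (z : T) j :
  precision_ip g z (0, delta_mx j 0) = z.2 j 0 / g j 0.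
Proof.
rewrite /precision_ip big1 ?mul0r ?add0r => [|k _]; last by rewrite mxE mulr0.
rewrite (bigD1 j)//= big1 ?addr0 => [|k kj]; last by rewrite mxE (negPf kj) mulr0 mul0r.
by rewrite mxE !eqxx mulr1.
Qed.

(** A coordinate of x is [g j 0] times the linear form in the direction [(0, delta_mx j 0)], so its
    moments are inherited from those of [precision_ip]. *)
Lemma sqr_integrable_x g j : positive_cV g ->
  sqr_integrable (P g) (fun w => X w j 0).
Proof.
move=> g0; have := sqr_integrableZ _ _ _ _ (g j 0) _
  (sqr_integrable_precision_ip g (0, delta_mx j 0) g0).
congr sqr_integrable; apply/funext => w.
by rewrite precision_ip_delta mulrC divfK// gt_eqF.
Qed.

Lemma sqr_integrable_x2 g j : positive_cV g ->
  sqr_integrable (P g) (fun w => X w j 0 ^+ 2).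
Proof.
move=> g0; have := sqr_integrableZ _ _ _ _ (g j 0 ^+ 2) _
  (sqr_integrable_precision_ip2 g (0, delta_mx j 0) g0).
congr sqr_integrable; apply/funext => w.
by rewrite precision_ip_delta -exprMn mulrC divfK// gt_eqF.
Qed.

Lemma Rintegral_precision_ip0 g (v : T) : positive_cV g ->
  \int[P g]_w precision_ip g (noise_x w) v = 0.
Proof.
move=> g0; rewrite -(Rintegral_precision_ip g (cst 1) 0 v g0)//.
- by apply: eq_Rintegral => w _; rewrite mul1r.
- exact: sqr_integrable_cst.
- by move=> h z; rewrite mulr0 subr0.
Qed.

Lemma Rintegral_x g j : positive_cV g -> \int[P g]_w X w j 0 = 0.
Proof.
move=> g0; have := Rintegral_precision_ip0 g (0, delta_mx j 0) g0.
under eq_Rintegral do rewrite precision_ip_delta mulrC.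
rewrite RintegralZ_prob; last by apply: sqr_integrableW; exact: sqr_integrable_x.
by move/eqP; rewrite mulf_eq0 invr_eq0 gt_eqF// => /eqP.
Qed.

Lemma measurable_snd_coord j : measurable_fun setT (fun z : T => z.2 j 0).
Proof. exact: (measurableT_comp (measurable_coord j) measurable_snd). Qed.

Lemma Rintegral_x_precision_ip g i (v : T) : positive_cV g ->
  \int[P g]_w (X w i 0 * precision_ip g (noise_x w) v) = v.2 i 0.
Proof.
move=> g0; apply: (Rintegral_precision_ip g (fun z : T => z.2 i 0)) => //.
- exact: measurable_snd_coord.
- exact: sqr_integrable_x.
- by move=> h z; rewrite !mxE.
Qed.

(** Stein's identity for the coordinate function itself, in the direction of that coordinate. *)
Lemma Rintegral_x2 g j : positive_cV g -> \int[P g]_w (X w j 0 ^+ 2) = g j 0.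
Proof.
move=> g0; have gj0 : g j 0 != 0 by rewrite gt_eqF.
have := Rintegral_x_precision_ip g j (0, delta_mx j 0) g0.
under eq_Rintegral do rewrite precision_ip_delta mulrA mulrC -expr2.
rewrite RintegralZ_prob; last by apply: sqr_integrableW; exact: sqr_integrable_x2.
by rewrite mxE !eqxx => /(canRL (mulKf (invr_neq0 gj0))); rewrite invrK mulr1.
Qed.

(** A linear form is affine along [v] with slope [precision_ip g u v], so Stein's identity applies.
    For the directions of the model this gives the x-block of the second moment of the score. *)
Lemma Rintegral_precision_ip2 g (u v : T) : positive_cV g ->
  \int[P g]_w (precision_ip g (noise_x w) u * precision_ip g (noise_x w) v) =
  precision_ip g u v.
Proof.
move=> g0; apply: (Rintegral_precision_ip g (fun z => precision_ip g z u)) => //.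
- exact: measurable_precision_ip.
- exact: sqr_integrable_precision_ip.
- move=> h z; rewrite ![precision_ip g _ u]precision_ipC -(scaleNr h v.1) -(scaleNr h v.2).
  by rewrite (precision_ipDr g u z (- h *: v.1, - h *: v.2)) precision_ipZr mulNr.
Qed.

(* The rescaled variance lies below [g j 0], which keeps the likelihood ratio
   bounded. *)
Lemma Rintegral_score_variance (g : 'cV[R]_L) j (f : T -> R) (a k : R) : positive_cV g ->
  measurable_fun setT f -> sqr_integrable (P g) (fun w => f (noise_x w)) ->
  (forall g', positive_cV g' -> (forall i, i != j -> g' i 0 = g i 0) ->
    (\int[P g']_w (f (noise_x w))%:E = (a + k * g' j 0)%:E)%E) ->
  \int[P g]_w (f (noise_x w) * (X w j 0 ^+ 2 / (2 * g j 0 ^+ 2) - (2 * g j 0)^-1)) = k.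
Proof.
move=> g0 mf sf fk.
have gj0 : g j 0 != 0 by rewrite gt_eqF.
pose b w := X w j 0 ^+ 2 / (2 * g j 0).
have b0 w : 0 <= b w by rewrite divr_ge0 ?sqr_ge0// mulr_ge0// ltW.
pose D w := 1 + b w.
(* Likelihood ratio of the variance [g j 0 / (1 + h)] against [g j 0], at [x = b w]: the square root
   comes from the normalising constants, the exponential from the precision growing by the factor
   [1 + h]. *)
pose rho h x := Num.sqrt (1 + h) * expR (- (h * x)) : R.
pose r n w := rho (harmonic n) (b w).
have mX : measurable_fun setT (fun w => X w j 0).
  exact: (measurableT_comp (measurable_coord j)).
have mb : measurable_fun setT b.
  by apply: measurable_funM => //; exact: measurable_funX.
have sb : sqr_integrable (P g) b.
  have := sqr_integrableZ _ _ _ _ (2 * g j 0)^-1 _ (sqr_integrable_x2 g j g0).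
  by congr sqr_integrable; apply/funext => w; rewrite mulrC.
(* The upper bound uses [Num.sqrt (1 + h) <= 1 + h] and an exponential at most 1; the lower bound
   uses a square root at least 1 and [expR (- (h x)) >= 1 - h x]. *)
have rho1 h x : 0 < h -> 0 <= x -> `|rho h x - 1| <= h * (1 + x).
  move=> h0 x0.
  have e1 : expR (- (h * x)) <= 1 by rewrite -expR0 ler_expR oppr_le0 mulr_ge0// ltW.
  have e2 := expR_ge1Dx (- (h * x)).
  have e3 := expR_gt0 (- (h * x)).
  have s1 : 1 <= Num.sqrt (1 + h) by rewrite -{1}sqrtr1 ler_wsqrtr// lerDl ltW.
  have s2 : Num.sqrt (1 + h) <= 1 + h.
    have : Num.sqrt (1 + h) <= Num.sqrt ((1 + h) ^+ 2) by rewrite ler_wsqrtr//; nra.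
    by rewrite sqrtr_sqr ger0_norm// addr_ge0// ltW.
  rewrite /rho ler_norml; nra.
have [_] : (P g).-integrable setT
      (EFin \o (fun w => f (noise_x w) * (2^-1 - b w))) /\
    \int[P g]_w (f (noise_x w) * (2^-1 - b w)) = - (k * g j 0).
  (* Passing from [g j 0] to [g j 0 / (1 + h)] changes [a + k * g j 0] by
     [- k * g j 0 * h / (1 + h)]; dividing by [h] gives the sequence of slopes. *)
  apply: (Rintegral_score _ _ _ (P g) _ D _ r harmonic
    (fun n => - (k * g j 0) / (1 + harmonic n))) => //.
  - by apply: sqr_integrableD => //; exact: sqr_integrable_cst.
  - exact: measurable_funB.
  - move=> n; apply: measurable_funM => //; apply: measurableT_comp => //.
    by apply: measurableT_comp => //; exact: measurable_funM.
  - by move=> n; exact: harmonic_gt0.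
  - by move=> n w; apply: rho1 => //; exact: harmonic_gt0.
  - move=> w; have -> : (fun n => (harmonic n)^-1 * (r n w - 1)) =
        fun n => (harmonic n)^-1 * (rho (harmonic n) (b w) - rho 0 (b w)).
      by apply/funext => n; rewrite /r /rho addr0 sqrtr1 mul0r oppr0 expR0 mul1r.
    apply: (cvg_slope_harmonic (rho^~ (b w))).
    pose p : {poly R} := 1 + 'X; pose q : {poly R} := - (b w *: 'X).
    have -> : rho^~ (b w) = (fun h => Num.sqrt p.[h]) * (fun h => expR q.[h]).
      apply/funext => h; rewrite /rho /p /q -[RHS]/(_ * _).
      by rewrite hornerD hornerC hornerX hornerN hornerZ hornerX mulrC (mulrC h) mulrC.
    have p0 : p.[0] = 1 by rewrite /p hornerD hornerC hornerX addr0.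
    have q0 : q.[0] = 0 by rewrite /q hornerN hornerZ hornerX mulr0 oppr0.
    have dp : is_derive (0 : R) 1 (fun h => Num.sqrt p.[h])
        ((2 * Num.sqrt p.[0])^-1 * p^`().[0]).
      apply: (is_derive1_comp (is_derive1_sqrt _) (is_derive_poly _ _)).
      by rewrite p0.
    apply: (@is_derive_eq _ _ _ _ _ _ _ _ (is_deriveM dp (is_derive_expR_poly q 0))).
    rewrite p0 q0 sqrtr1 expR0 /p /q derivD derivC derivX derivN derivZ derivX.
    rewrite hornerD hornerN hornerZ !hornerC /GRing.scale /=.
    by lra.
  - move=> n; set h := harmonic n; have h0 : 0 < h by exact: harmonic_gt0.
    have h1 : 1 + h != 0 by rewrite gt_eqF// addr_gt0.
    pose g' : 'cV[R]_L := \col_i (g i 0 / (if i == j then 1 + h else 1)).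
    have g'0 : positive_cV g'.
      by move=> i; rewrite mxE divr_gt0//; case: ifP => // _; rewrite addr_gt0.
    have g'E : (forall i, i != j -> g' i 0 = g i 0).
      by move=> i ij; rewrite mxE (negPf ij) divr1.
    have pdfE (z : T) : noise_x_pdf g' z =
        rho h (z.2 j 0 ^+ 2 / (2 * g j 0)) * noise_x_pdf g z.
      rewrite !noise_x_pdfE//.
      have -> : \prod_i g' i 0 = \prod_i g i 0 / (1 + h).
        under eq_bigr do rewrite mxE.
        by rewrite prodf_div -[X in _ / X]big_mkcond big_pred1_eq.
      have -> : precision_ip g' z z = precision_ip g z z + h * (z.2 j 0 ^+ 2 / g j 0).
        rewrite /precision_ip -addrA; congr (_ + _).
        rewrite (bigD1 j)//= [in RHS](bigD1 j)//= mxE eqxx addrAC; congr (_ + _).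
          by field; rewrite ?h1 ?gj0.
        by apply: eq_bigr => i ij; rewrite g'E.
      have -> : Num.sqrt ((2 * pi) ^+ L * (\prod_i g i 0 / (1 + h))) =
          Num.sqrt ((2 * pi) ^+ L * \prod_i g i 0) / Num.sqrt (1 + h).
        rewrite mulrA sqrtrM ?sqrtrV// ?addr_ge0 ?(ltW h0)//.
        rewrite mulr_ge0 ?exprn_ge0 ?mulr_ge0 ?pi_ge0// prodr_ge0// => i _.
        exact/ltW/g0.
      have -> : expR (- (precision_ip g z z + h * (z.2 j 0 ^+ 2 / g j 0)) / 2) =
          expR (- (h * (z.2 j 0 ^+ 2 / (2 * g j 0)))) * expR (- precision_ip g z z / 2).
        by rewrite -expRD; congr expR; field.
      by rewrite invf_div /rho; ring.
    rewrite (fk g)// -EFinD.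
    (* The laws [P g] and [P g'] are compared through Lebesgue measure, where [pdfE] relates their
       densities. *)
    transitivity (\int[P g']_w (f (noise_x w))%:E)%E; last first.
      rewrite fk// /g' mxE eqxx; congr EFin; rewrite -/h.
      by field.
    have mrho : measurable_fun setT
        (fun z : T => f z * rho h (z.2 j 0 ^+ 2 / (2 * g j 0))).
      apply: measurable_funM => //; apply: measurable_funM => //.
      apply: measurableT_comp => //; apply: measurableT_comp => //.
      apply: measurable_funM => //; apply: measurable_funM => //.
      have mj := measurable_snd_coord j; exact: measurable_funX.
    have mZ := measurable_noise_x.
    rewrite (integral_density _ _ _ (P g) _ _ (lebesgue_cV N \x lebesgue_cV L)%E
      noise_x (noise_x_pdf g) _ _ _ _
      (fun z => (f z * rho h (z.2 j 0 ^+ 2 / (2 * g j 0)))%:E)); first last.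
    + exact/measurable_EFinP.
    + exact: has_density_noise_x.
    + exact: noise_x_pdf_ge0.
    + exact: measurable_noise_x_pdf.
    + by [].
    rewrite (integral_density _ _ _ (P g') _ _ (lebesgue_cV N \x lebesgue_cV L)%E
      noise_x (noise_x_pdf g') _ _ _ _ (fun z => (f z)%:E)); first last.
    + exact/measurable_EFinP.
    + exact: has_density_noise_x.
    + exact: noise_x_pdf_ge0.
    + exact: measurable_noise_x_pdf.
    + by [].
    by apply: eq_integral => z _; rewrite -!EFinM pdfE -mulrA.
  - rewrite -[X in _ --> X]divr1; apply: cvgM; first exact: cvg_cst.
    apply: cvgV => //; rewrite -[X in _ --> X]addr0.
    by apply: cvgD; [exact: cvg_cst|exact: cvg_harmonic].
move=> E.
(* Chain rule: [g j 0 / (1 + h)] has derivative [- g j 0] at [h = 0], so the derivative in the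
   variance is the one in [h] times [- (g j 0)^-1]. *)
transitivity (\int[P g]_w (- (g j 0)^-1 * (f (noise_x w) * (2^-1 - b w)))).
  by apply: eq_Rintegral => w _; rewrite /b; field.
rewrite RintegralZ_prob ?E; first by field.
by apply: sqr_integrableM => //; apply: sqr_integrableB => //; exact: sqr_integrable_cst.
Qed.

End gaussian_model.

Arguments precision_ip {R N L}.
Arguments noise_x_pdf {R N L}.
Arguments noise_x {R N L d Omega}.

(** * Derivatives of the log density *)

Lemma derive_line {R : realType} n (f : 'cV[R]_n -> R) (t v : 'cV[R]_n) :
  'D_v f t = 'D_1 (fun h : R => f (h *: v + t)) 0.
Proof.
rewrite /derive.
suff -> : (fun h : R => h^-1 *: ((f \o shift t) (h *: v) - f t)) =
  (fun h : R => h^-1 *: (((fun h => f (h *: v + t)) \o shift 0) (h *: (1 : R)) -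
    f ((0 : R) *: v + t))) by [].
apply/funext => h /=.
by rewrite scale0r add0r addr0 [_ *: 1]mulr1.
Qed.

(** Equality near 0 is what can be used along the gamma-directions: the closed form of the log
    density is available at positive parameters only, and these form a neighbourhood of 0 on the
    line. *)
Lemma derive_line_near {R : realType} n (f : 'cV[R]_n -> R) (F : R -> R)
    (t v : 'cV[R]_n) (l : R) :
  (\forall h \near (0 : R), f (h *: v + t) = F h) -> is_derive (0 : R) 1 F l ->
  'D_v f t = l.
Proof.
move=> fF dF; rewrite derive_line.
by rewrite (@near_eq_derive _ _ _ _ F 0 1 fF) derive_val.
Qed.

Lemma near0_addr_gt0 {R : realType} (c : R) : 0 < c ->
  \forall h \near (0 : R), 0 < c + h.
Proof.
move=> c0; near=> h; have : `|0 - h| < c by near: h; exact: nbhsx_ballx.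
by rewrite sub0r normrN ltr_norml => /andP[]; rewrite -subr_gt0 opprK addrC.
Unshelve. all: by end_near. Qed.

Lemma is_derive_inv_addr {R : realType} (c : R) : c != 0 ->
  is_derive (0 : R) 1 (fun h => (c + h)^-1) (- c ^- 2).
Proof.
move=> c0; pose p : {poly R} := 'X + c%:P.
have pE h : p.[h] = c + h by rewrite /p hornerD hornerX hornerC addrC.
have := @is_deriveV _ _ _ _ _ _ (is_derive_poly p 0).
rewrite (_ : (fun h => _) = fun h => (c + h)^-1); last by apply/funext => h; rewrite pE.
rewrite pE addr0 => /(_ c0).
by rewrite /p derivD derivX derivC addr0 hornerC [_ *: 1]mulr1.
Qed.

Lemma is_derive_ln_addr {R : realType} (c : R) : 0 < c ->
  is_derive (0 : R) 1 (fun h => ln (c + h)) c^-1.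
Proof.
move=> c0; pose p : {poly R} := 'X + c%:P.
have pE h : p.[h] = c + h by rewrite /p hornerD hornerX hornerC addrC.
have dl : is_derive p.[0] 1 (@ln R) p.[0]^-1 by apply: is_derive1_ln; rewrite pE addr0.
have := is_derive1_comp dl (is_derive_poly p 0).
rewrite (_ : @ln R \o _ = fun h => ln (c + h)); last by apply/funext => h /=; rewrite pE.
by rewrite pE addr0 /p derivD derivX derivC addr0 hornerC mulr1.
Qed.

Lemma is_derive_quadratic {R : realType} (a b c : R) :
  is_derive (0 : R) 1 (fun h => a + h * b + h ^+ 2 * c) b.
Proof.
pose p : {poly R} := a%:P + b *: 'X + c *: 'X^2.
rewrite (_ : (fun h => _) = fun h => p.[h]); last first.
  apply/funext => h.
  by rewrite /p !hornerD hornerC !hornerZ hornerX hornerXn [b * h]mulrC [c * _]mulrC.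
apply: (@is_derive_eq _ _ _ _ _ _ _ _ (is_derive_poly p 0)).
rewrite /p !derivD derivC !derivZ derivX derivXn expr1 add0r.
by rewrite hornerD !hornerZ hornerMn hornerX hornerC mul0rn mulr0 addr0 mulr1.
Qed.

(** One family for all derivatives in a variance: the log density involves the logarithm and the
    inverse, its first derivative the inverse and the squared inverse. *)
Lemma is_derive_ln_inv_addr {R : realType} (a b c e g : R) : 0 < g ->
  is_derive (0 : R) 1
    (fun h => a + b * ln (g + h) + c * (g + h)^-1 + e * ((g + h)^-1 * (g + h)^-1))
    (b * g^-1 - c * g ^- 2 - 2 * e * g ^- 3).
Proof.
move=> g0; have gn0 : g != 0 by rewrite gt_eqF.
have dinv := is_derive_inv_addr g gn0.
have H := is_deriveD (is_deriveD (is_deriveD (is_derive_cst a (0 : R) 1)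
  (is_deriveZ b (is_derive_ln_addr g g0))) (is_deriveZ c dinv))
  (is_deriveZ e (is_deriveM dinv dinv)).
apply: (@is_derive_eq _ _ _ _ _ _ _ _ H).
by rewrite /GRing.scale /= addr0; field.
Qed.

Section log_density.
Context (R : realType) (N L : nat) (Phi : 'M[R]_(N, L)) (sigma2 : R).
Hypothesis sigma2_gt0 : 0 < sigma2.

(** Velocity of [(y - Phi x, x)] when x moves along the j-th basis vector and y stays fixed. *)
Definition direction (j : 'I_L) : 'cV[R]_N * 'cV[R]_L :=
  (- (Phi *m delta_mx j 0), delta_mx j 0).

(** This Gram matrix is the upper left block of H. It arises both as minus the Hessian in x and as
    the covariance of the x-part of the score. *)
Lemma precision_ip_direction g i j :
  precision_ip sigma2 g (direction i) (direction j) =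
  (sigma2^-1 *: (Phi^T *m Phi)) i j + (g i 0)^-1 *+ (i == j).
Proof.
rewrite /precision_ip /= !mxE mulrC; congr (_ * _ + _).
  apply: eq_bigr => k _; rewrite !mxE mulrNN.
  have E (l : 'I_L) : \sum_m Phi k m * (delta_mx l (0 : 'I_1) : 'cV[R]_L) m 0 = Phi k l.
    rewrite (bigD1 l)//= big1 ?addr0 => [|m ml]; last by rewrite mxE (negPf ml) mulr0.
    by rewrite mxE !eqxx mulr1.
  by rewrite !E.
rewrite (bigD1 i)//= big1 ?addr0 => [|m mi].
  by rewrite !mxE !eqxx mul1r andbT; case: eqVneq; rewrite ?mul1r// mul0r.
by rewrite !mxE (negPf mi) !mul0r.
Qed.

Lemma joint_pdf_noise_x_pdf y x g :
  joint_pdf Phi sigma2 y x g = noise_x_pdf sigma2 g (y - Phi *m x, x).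
Proof. by rewrite /joint_pdf /noise_x_pdf /gaussian_pdf !subr0. Qed.

Lemma ln_joint_pdf y x g : positive_cV g -> ln (joint_pdf Phi sigma2 y x g) =
  - ln ((2 * pi) ^+ N * sigma2 ^+ N) / 2 - ln ((2 * pi) ^+ L) / 2
  - (\sum_i ln (g i 0)) / 2
  - precision_ip sigma2 g (y - Phi *m x, x) (y - Phi *m x, x) / 2.
Proof.
move=> g0; rewrite joint_pdf_noise_x_pdf noise_x_pdfE//.
have sqrtE (a : R) : 0 < a -> (Num.sqrt a)^-1 = expR (- ln a / 2).
  move=> a0; rewrite mulNr expRN; congr _^-1; apply/eqP.
  rewrite -(@eqrXn2 _ 2) ?sqrtr_ge0 ?expR_ge0// sqr_sqrtr ?ltW//.
  by rewrite -expRM_natl mulrC divfK// lnK// posrE.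
have pi2 n : 0 < (2 * pi : R) ^+ n by rewrite exprn_gt0// mulr_gt0// pi_gt0.
have prod_gt0 : 0 < \prod_i g i 0 by apply: prodr_gt0 => i _; exact: g0.
have lnprod : ln (\prod_i g i 0) = \sum_i ln (g i 0).
  rewrite -[RHS]expRK expR_sum; congr ln; apply: eq_bigr => i _.
  by rewrite lnK// posrE g0.
rewrite sqrtE ?(mulr_gt0 (pi2 _)) ?exprn_gt0//.
rewrite sqrtE ?(mulr_gt0 (pi2 _))// -!expRD expRK.
rewrite [ln (_ * \prod_i _)]lnM ?posrE// lnprod.
by field.
Qed.


Lemma precision_ip_eq_except (g g' : 'cV[R]_L) i (z v : 'cV[R]_N * 'cV[R]_L) :
  (forall k, k != i -> g' k 0 = g k 0) ->
  precision_ip sigma2 g' z v = precision_ip sigma2 g z v +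
    z.2 i 0 * v.2 i 0 * ((g' i 0)^-1 - (g i 0)^-1).
Proof.
move=> gg'; rewrite /precision_ip -addrA; congr (_ + _).
rewrite (bigD1 i)//= [in RHS](bigD1 i)//= addrAC; congr (_ + _).
  by rewrite mulrBr addrC subrK.
by apply: eq_bigr => k ki; rewrite gg'.
Qed.

Lemma usubmx_line_lshift (t : 'cV[R]_(L + L)) h j :
  usubmx (h *: delta_mx (lshift L j) 0 + t) = h *: delta_mx j 0 + usubmx t.
Proof. by apply/matrixP => i k; rewrite !mxE eq_lshift. Qed.

Lemma dsubmx_line_lshift (t : 'cV[R]_(L + L)) h j :
  dsubmx (h *: delta_mx (lshift L j) 0 + t) = dsubmx t.
Proof. by apply/matrixP => i k; rewrite !mxE eq_rlshift mulr0 add0r. Qed.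

Lemma usubmx_line_rshift (t : 'cV[R]_(L + L)) h j :
  usubmx (h *: delta_mx (rshift L j) 0 + t) = usubmx t.
Proof. by apply/matrixP => i k; rewrite !mxE eq_lrshift mulr0 add0r. Qed.

Lemma dsubmx_line_rshift (t : 'cV[R]_(L + L)) h j :
  dsubmx (h *: delta_mx (rshift L j) 0 + t) = h *: delta_mx j 0 + dsubmx t.
Proof. by apply/matrixP => i k; rewrite !mxE eq_rshift. Qed.

Definition residual (y : 'cV[R]_N) (t : 'cV[R]_(L + L)) :
    'cV[R]_N * 'cV[R]_L :=
  (y - Phi *m usubmx t, usubmx t).

(** Written in closed form so that it can be differentiated again and its moments computed;
    [derive_ln_joint_pdf] identifies it with the gradient of the log density. *)
Definition score (y : 'cV[R]_N) (t : 'cV[R]_(L + L)) : 'cV[R]_(L + L) :=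
  col_mx
    (\col_j - precision_ip sigma2 (dsubmx t) (residual y t) (direction j))
    (\col_j (usubmx t j 0 ^+ 2 / (2 * dsubmx t j 0 ^+ 2) -
             (2 * dsubmx t j 0)^-1)).

Lemma residual_line_lshift y t h j :
  residual y (h *: delta_mx (lshift L j) 0 + t) =
  ((residual y t).1 + h *: (direction j).1, (residual y t).2 + h *: (direction j).2).
Proof.
rewrite /residual usubmx_line_lshift /=; congr (_, _); last by rewrite addrC.
by rewrite mulmxDr -scalemxAr scalerN opprD addrA addrAC.
Qed.

Lemma residual_line_rshift y t h j :
  residual y (h *: delta_mx (rshift L j) 0 + t) = residual y t.
Proof. by rewrite /residual usubmx_line_rshift. Qed.

Lemma near_positive_cV_line (t : 'cV[R]_(L + L)) i :
  positive_cV (dsubmx t) ->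
  \forall h \near (0 : R), positive_cV (dsubmx (h *: delta_mx i 0 + t)).
Proof.
move=> t0; case: (split_ordP i) => j ->.
  by apply: filterE => h; rewrite dsubmx_line_lshift.
apply: filterS (near0_addr_gt0 _ (t0 j)) => h tjh k.
rewrite dsubmx_line_rshift 2!mxE.
have [->|kj] := eqVneq k j; last by rewrite mxE (negPf kj) mulr0 add0r t0.
by rewrite mxE !eqxx mulr1 addrC.
Qed.

Lemma derive_ln_joint_pdf y t i : positive_cV (dsubmx t) ->
  'D_(delta_mx i 0) (fun t => ln (joint_pdf Phi sigma2 y (usubmx t) (dsubmx t))) t =
  score y t i 0.
Proof.
move=> t0; case: (split_ordP i) => j ->.
  rewrite col_mxEu mxE.
  pose f0 := ln (joint_pdf Phi sigma2 y (usubmx t) (dsubmx t)).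
  pose c := precision_ip sigma2 (dsubmx t) (direction j) (direction j).
  apply: derive_line_near (is_derive_quadratic f0 _ (- (c / 2))).
  apply: filterE => h; rewrite dsubmx_line_lshift /f0 !ln_joint_pdf//.
  rewrite -/(residual y (h *: _ + t)) -/(residual y t) residual_line_lshift.
  rewrite [precision_ip _ _ ((residual y t).1 + _, _) _](precision_ipDD R N L
    sigma2 (dsubmx t) (residual y t) (h *: (direction j).1, h *: (direction j).2)).
  rewrite !precision_ipZr.
  rewrite [precision_ip _ _ (_ *: _, _ *: _) (direction j)]precision_ipC.
  rewrite precision_ipZr -/c.
  by field.
rewrite col_mxEd mxE; set g := dsubmx t; set x := usubmx t.
have gj0 : 0 < g j 0 by exact: t0.
pose f0 := ln (joint_pdf Phi sigma2 y x g).
(* The terms of [f0] that contain the j-th variance are added back, so that the function of [h]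
   below takes the value [f0] at [h = 0]. *)
pose a := f0 + ln (g j 0) / 2 + x j 0 ^+ 2 / g j 0 / 2.
apply: (@derive_line_near _ _ _
  (fun h => a + - 2^-1 * ln (g j 0 + h) + - (x j 0 ^+ 2 / 2) * (g j 0 + h)^-1 +
            0 * ((g j 0 + h)^-1 * (g j 0 + h)^-1))); last first.
  apply: is_derive_eq (is_derive_ln_inv_addr _ _ _ _ _ gj0) _.
  by field; rewrite gt_eqF.
near=> h.
have t'0 : positive_cV (dsubmx (h *: delta_mx (rshift L j) 0 + t)).
  by near: h; exact: near_positive_cV_line.
rewrite /a /f0 !ln_joint_pdf//.
rewrite -/(residual y (h *: _ + t)) -/(residual y t) residual_line_rshift.
have gE k : k != j -> dsubmx (h *: delta_mx (rshift L j) 0 + t) k 0 = g k 0.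
  by move=> kj; rewrite dsubmx_line_rshift 3!mxE (negPf kj) mulr0 add0r.
have gjE : dsubmx (h *: delta_mx (rshift L j) 0 + t) j 0 = g j 0 + h.
  by rewrite dsubmx_line_rshift 3!mxE !eqxx mulr1 addrC.
rewrite (precision_ip_eq_except g _ j)// gjE.
have -> : \sum_i ln (dsubmx (h *: delta_mx (rshift L j) 0 + t) i 0) =
    \sum_i ln (g i 0) + (ln (g j 0 + h) - ln (g j 0)).
  rewrite (bigD1 j)//= [in RHS](bigD1 j)//= gjE addrAC; congr (_ + _).
    by rewrite addrC subrK.
  by apply: eq_bigr => k kj; rewrite gE.
rewrite /= -/x -/g; set S := \sum_i _; set Q := precision_ip _ _ _ _.
have g'j0 : g j 0 + h != 0 by rewrite -gjE gt_eqF.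
by field; rewrite g'j0 gt_eqF.
Unshelve. all: by end_near. Qed.

(** To differentiate twice, the first derivative must be known on a neighbourhood; positivity of the
    parameter persists near [t] along every coordinate line. *)
Lemma derive2_ln_joint_pdf y t i j (F : R -> R) (l : R) :
  positive_cV (dsubmx t) ->
  (\forall h \near (0 : R), score y (h *: delta_mx i 0 + t) j 0 = F h) ->
  is_derive (0 : R) 1 F l ->
  'D_(delta_mx i 0) ('D_(delta_mx j 0)
    (fun t => ln (joint_pdf Phi sigma2 y (usubmx t) (dsubmx t)))) t = l.
Proof.
move=> t0 sF dF; apply: derive_line_near dF; near=> h.
rewrite derive_ln_joint_pdf; first by near: h.
by near: h; exact: near_positive_cV_line.
Unshelve. all: by end_near. Qed.

(** The upper left block depends on the parameter [dsubmx t] alone, the off-diagonal blocks are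
    linear in x, and the last block is affine in the squares of the coordinates of x. The first two
    moments of x therefore determine the expectation. *)
Lemma hessian_ln_joint_pdf y t : positive_cV (dsubmx t) ->
  hessian (fun t => ln (joint_pdf Phi sigma2 y (usubmx t) (dsubmx t))) t =
  block_mx
    (\matrix_(i, j) - precision_ip sigma2 (dsubmx t) (direction i) (direction j))
    (\matrix_(i, j) (usubmx t j 0 / dsubmx t j 0 ^+ 2 *+ (i == j)))
    (\matrix_(i, j) (usubmx t j 0 / dsubmx t j 0 ^+ 2 *+ (i == j)))
    (\matrix_(i, j) (((2 * dsubmx t j 0 ^+ 2)^-1 -
      usubmx t j 0 ^+ 2 / dsubmx t j 0 ^+ 3) *+ (i == j))).
Proof.
move=> t0; apply/matrixP => i j; rewrite mxE.
set x := usubmx t; set g := dsubmx t.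
case: (split_ordP i) => i' ->; case: (split_ordP j) => j' ->.
- rewrite block_mxEul mxE.
  apply: derive2_ln_joint_pdf => //; last first.
    exact: (is_derive_quadratic (score y t (lshift L j') 0) _ 0).
  apply: filterE => h; rewrite !col_mxEu !mxE dsubmx_line_lshift residual_line_lshift.
  rewrite precision_ipC (precision_ipDr R N L sigma2 g (direction j')
    (residual y t) (h *: (direction i').1, h *: (direction i').2)) precision_ipZr.
  rewrite -/g [X in X + _]precision_ipC [X in h * X]precision_ipC.
  by ring.
- rewrite block_mxEur mxE.
  have gj0 : g j' 0 != 0 by rewrite gt_eqF// t0.
  apply: derive2_ln_joint_pdf => //; last first.
    apply: is_derive_eq (is_derive_quadratic (score y t (rshift L j') 0)
      (x j' 0 / g j' 0 ^+ 2 *+ (i' == j')) ((2 * g j' 0 ^+ 2)^-1 *+ (i' == j'))) _.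
    by [].
  apply: filterE => h; rewrite !col_mxEd [LHS]mxE [X in _ = X + _ + _]mxE.
  rewrite dsubmx_line_lshift usubmx_line_lshift -/x -/g 3!mxE eqxx andbT eq_sym.
  case: eqVneq => _; rewrite ?mulr1n ?mulr0n; last by rewrite !mulr0 add0r !addr0.
  by field.
- rewrite block_mxEdl mxE.
  have gi0 : 0 < g i' 0 by exact: t0.
  apply: (@derive2_ln_joint_pdf _ _ _ _ (fun h => score y t (lshift L j') 0
     + x i' 0 / g i' 0 *+ (i' == j') + 0 * ln (g i' 0 + h)
     + - (x i' 0 *+ (i' == j')) * (g i' 0 + h)^-1
     + 0 * ((g i' 0 + h)^-1 * (g i' 0 + h)^-1)) _ t0);
    last first.
    apply: is_derive_eq (is_derive_ln_inv_addr _ _ _ _ _ gi0) _.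
    case: eqVneq => [<-|_]; rewrite ?mulr1n ?mulr0n; last by rewrite oppr0 !(mul0r, mulr0, subr0).
    by field; rewrite gt_eqF.
  apply: filterE => h; rewrite !col_mxEu [LHS]mxE [X in _ = X + _ + _ + _ + _]mxE.
  rewrite residual_line_rshift (precision_ip_eq_except g _ i'); last first.
    by move=> k ki; rewrite dsubmx_line_rshift 3!mxE (negPf ki) mulr0 add0r.
  have -> : dsubmx (h *: delta_mx (rshift L i') 0 + t) i' 0 = g i' 0 + h.
    by rewrite dsubmx_line_rshift 3!mxE !eqxx mulr1 addrC.
  rewrite [(direction j').2 i' 0]mxE eqxx andbT -/x.
  case: eqVneq => _; rewrite ?mulr1n ?mulr0n /=; last by ring.
  by ring.
- rewrite block_mxEdr mxE.
  have gi0 : 0 < g i' 0 by exact: t0.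
  have [<-|ij] := eqVneq i' j'; last first.
    rewrite mulr0n; apply: (@derive2_ln_joint_pdf _ _ _ _
      (fun h => score y t (rshift L j') 0 + h * 0 + h ^+ 2 * 0) _ t0); last first.
      exact: (is_derive_quadratic (score y t (rshift L j') 0) 0 0).
    apply: filterE => h; rewrite !mulr0 !addr0 !col_mxEd [LHS]mxE [RHS]mxE.
    rewrite usubmx_line_rshift dsubmx_line_rshift.
    have -> // : (h *: delta_mx i' 0 + dsubmx t) j' 0 = dsubmx t j' 0.
    by rewrite 3!mxE eq_sym (negPf ij) mulr0 add0r.
  rewrite mulr1n; apply: (@derive2_ln_joint_pdf _ _ _ _ (fun h => 0 + 0 * ln (g i' 0 + h)
     + - 2^-1 * (g i' 0 + h)^-1
     + (x i' 0 ^+ 2 / 2) * ((g i' 0 + h)^-1 * (g i' 0 + h)^-1)) _ t0);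
    last first.
    apply: is_derive_eq (is_derive_ln_inv_addr _ _ _ _ _ gi0) _.
    by field; rewrite gt_eqF.
  near=> h; rewrite !col_mxEd [LHS]mxE.
  rewrite usubmx_line_rshift dsubmx_line_rshift -/x.
  have -> : (h *: delta_mx i' 0 + dsubmx t) i' 0 = g i' 0 + h.
    by rewrite 3!mxE !eqxx mulr1 addrC.
  have : 0 < g i' 0 + h by near: h; exact: near0_addr_gt0.
  by move=> gh; field; rewrite gt_eqF.
Unshelve. all: by end_near.
Qed.

End log_density.

Arguments direction {R N L}.
Arguments residual {R N L}.
Arguments score {R N L}.

(** * The Cramer-Rao inequality *)

Lemma expectation_mxE {d} {Omega : measurableType d} {R : realType}
    (P : probability Omega R) m n (M : Omega -> 'M[R]_(m, n)) i j :
  expectation_mx P M i j = \int[P]_w M w i j.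
Proof. by rewrite mxE unlock. Qed.

Lemma posdef_unitmx {R : realType} n (A : 'M[R]_n) :
  (forall v : 'cV[R]_n, v != 0 -> 0 < (v^T *m A *m v) 0 0) -> A \in unitmx.
Proof.
move=> A0; rewrite -row_free_unit; apply: inj_row_free => v vA.
apply/eqP; apply: contraT => v0; have := A0 v^T.
by rewrite trmxK vA mul0mx mxE ltxx => /(_ _)/negP; rewrite trmx_eq0 v0; case.
Qed.

(** Reduces a quadratic form of moment matrices to the expectation of a product of scalar random
    variables, so that the matrix inequality becomes positivity of the mean of a square. *)
Lemma bilinear_expectation_mx {d} {Omega : measurableType d} {R : realType}
    (P : probability Omega R) n (A B : Omega -> 'cV[R]_n) (p q : 'cV[R]_n) :
  (forall i, sqr_integrable P (fun w => A w i 0)) ->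
  (forall i, sqr_integrable P (fun w => B w i 0)) ->
  (p^T *m expectation_mx P (fun w => A w *m (B w)^T) *m q) 0 0 =
  \int[P]_w ((p^T *m A w) 0 0 * (q^T *m B w) 0 0).
Proof.
move=> sA sB.
have iAB i j : P.-integrable setT (EFin \o (fun w => A w i 0 * B w j 0)).
  exact: sqr_integrableM.
have iABc i j (c : R) : P.-integrable setT (EFin \o (fun w => c * (A w i 0 * B w j 0))).
  under [X in integrable _ _ X]eq_fun do rewrite /= EFinM.
  exact: (integrableZl measurableT c (iAB i j)).
transitivity (\int[P]_w (\sum_j \sum_i p i 0 * q j 0 * (A w i 0 * B w j 0))).
  rewrite Rintegral_sum_fun => [|j]; last exact: integrable_sum_fun.
  rewrite mxE; apply: eq_bigr => j _; rewrite Rintegral_sum_fun// mxE mulr_suml.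
  apply: eq_bigr => i _; rewrite RintegralZ_prob// mxE expectation_mxE mulrAC.
  congr (_ * _); apply: eq_Rintegral => w _.
  by rewrite mxE big_ord1 mxE.
apply: eq_Rintegral => w _; rewrite !mxE mulr_suml exchange_big.
apply: eq_bigr => i _; rewrite mulr_sumr; apply: eq_bigr => j _.
by rewrite !mxE; ring.
Qed.

(* The Cramer-Rao argument: [E (v^T e + v^T H^-1 s)^2 >= 0]. *)
Lemma loewner_ge_inv_information {d} {Omega : measurableType d} {R : realType}
    (P : probability Omega R) n (e s : Omega -> 'cV[R]_n) (H : 'M[R]_n) :
  (forall i, sqr_integrable P (fun w => e w i 0)) ->
  (forall i, sqr_integrable P (fun w => s w i 0)) ->
  H \in unitmx -> H^T = H ->
  expectation_mx P (fun w => s w *m (s w)^T) = H ->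
  expectation_mx P (fun w => e w *m (s w)^T) = - 1%:M ->
  loewner_ge (expectation_mx P (fun w => e w *m (e w)^T)) (invmx H).
Proof.
move=> se ss uH HT Ess Ees; split.
  rewrite linearB/= trmx_inv HT; congr (_ - _); apply/matrixP => i j.
  rewrite mxE !expectation_mxE; apply: eq_Rintegral => w _.
  by rewrite !mxE !big_ord1 !mxE mulrC.
(* As [H] is symmetric, [u^T s] is the term [v^T H^-1 s] added to [v^T e]. *)
move=> v; pose u := invmx H *m v.
pose a w := (v^T *m e w) 0 0; pose b w := (u^T *m s w) 0 0.
have lin_sqr (p : 'cV[R]_n) (A : Omega -> 'cV[R]_n) :
    (forall i, sqr_integrable P (fun w => A w i 0)) ->
    sqr_integrable P (fun w => (p^T *m A w) 0 0).
  move=> sA; under eq_fun do rewrite mxE.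
  by apply: sqr_integrable_sum => i; exact: sqr_integrableZ.
have sa : sqr_integrable P a by exact: lin_sqr.
have sb : sqr_integrable P b by exact: lin_sqr.
have uHu : (u^T *m H *m u) 0 0 = (v^T *m invmx H *m v) 0 0.
  by rewrite /u trmx_mul trmx_inv HT -!mulmxA mulKVmx.
have : 0 <= \int[P]_w ((a w + b w) * (a w + b w)).
  by apply: Rintegral_ge0 => w _; rewrite -expr2 sqr_ge0.
have -> : \int[P]_w ((a w + b w) * (a w + b w)) =
    \int[P]_w (a w * a w) + 2 * \int[P]_w (a w * b w) + \int[P]_w (b w * b w).
  have iab : P.-integrable setT (EFin \o (fun w => 2 * (a w * b w))).
    under [X in integrable _ _ X]eq_fun do rewrite /= EFinM.
    exact: (integrableZl measurableT 2 (sqr_integrableM _ _ _ _ _ _ sa sb)).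
  have iaa := sqr_integrableM _ _ _ _ _ _ sa sa.
  rewrite -RintegralZ_prob; last exact: sqr_integrableM.
  rewrite -RintegralD// -RintegralD//; first last.
  - exact: sqr_integrableM.
  - by under [X in integrable _ _ X]eq_fun do rewrite /= EFinD; exact: integrableD.
  by apply: eq_Rintegral => w _; ring.
(* The cross term contributes [- 2 v^T H^-1 v] and the square of [b] contributes [v^T H^-1 v], which
   leaves exactly one negative copy. *)
rewrite -!bilinear_expectation_mx// Ess Ees uHu.
rewrite mulmxN mulmx1 mulNmx [X in _ + 2 * X + _]mxE /u mulmxA.
rewrite mulmxBr mulmxBl [X in _ -> 0 <= X]mxE [X in _ -> 0 <= _ + X]mxE.
by lra.
Qed.

(** * The information matrix of the sparse linear model *)

Section information.
Context (R : realType) (N L : nat) (Phi : 'M[R]_(N, L)) (sigma2 : R).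
Hypothesis sigma2_gt0 : 0 < sigma2.
Context d (Omega : measurableType d) (P : 'cV[R]_L -> probability Omega R).
Context (X : {mfun Omega >-> 'cV[R]_L}) (noise : {mfun Omega >-> 'cV[R]_N}).
Hypothesis X_gaussian : forall g, positive_cV g -> gaussian (P g) X 0 (Upsilon g).
Hypothesis noise_gaussian : forall g, positive_cV g ->
  gaussian (P g) noise 0 sigma2%:M.
Hypothesis X_noise_independent : forall g, positive_cV g ->
  independent (P g) X noise.
Variable g : 'cV[R]_L.
Hypothesis g_gt0 : positive_cV g.

Let Z := noise_x X noise.
Let Y := observation Phi X noise.

Definition information_mx : 'M[R]_(L + L) :=
  block_mx (sigma2^-1 *: (Phi^T *m Phi) + invmx (Upsilon g)) 0
           0 (invmx (diag_mx (\row_i (2 * g i 0 ^+ 2)))).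

Let invmx_Upsilon : invmx (Upsilon g) = diag_mx (\row_i (g i 0)^-1).
Proof.
rewrite /Upsilon (invmx_diag_mx _ _ _).2 => [|i]; last by rewrite mxE gt_eqF.
by congr diag_mx; apply/rowP => i; rewrite !mxE.
Qed.

Let variance_neq0 i : (\row_i (2 * g i 0 ^+ 2)) 0 i != 0.
Proof. by rewrite mxE gt_eqF// mulr_gt0// exprn_gt0. Qed.

Lemma information_mxE : information_mx = block_mx
  (\matrix_(i, j) precision_ip sigma2 g (direction Phi i) (direction Phi j)) 0
  0 (\matrix_(i, j) ((2 * g j 0 ^+ 2)^-1 *+ (i == j))).
Proof.
rewrite /information_mx invmx_Upsilon (invmx_diag_mx _ _ variance_neq0).2.
congr block_mx; apply/matrixP => i j; last first.
  by rewrite !mxE; case: eqVneq => [->|_].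
by rewrite [RHS]mxE precision_ip_direction mxE; congr (_ + _); rewrite !mxE.
Qed.

Lemma trmx_information_mx : information_mx^T = information_mx.
Proof.
rewrite information_mxE tr_block_mx !trmx0; congr block_mx;
  apply/matrixP => i j; rewrite !mxE; first by rewrite precision_ipC.
by rewrite eq_sym; case: eqVneq => [->|_].
Qed.

(** [Phi^T Phi] may be singular, for instance when [L > N]; the positive definite prior term
    [Upsilon^-1] makes the upper left block invertible. *)
Lemma information_mx_unit : information_mx \in unitmx.
Proof.
rewrite block_diag_mx_unit unitmx_inv (invmx_diag_mx _ _ variance_neq0).1 andbT.
apply: posdef_unitmx => v v0.
rewrite invmx_Upsilon mulmxDr mulmxDl mxE ltr_wpDl//.
  rewrite -scalemxAr -scalemxAl mxE mulr_ge0 ?invr_ge0 ?(ltW sigma2_gt0)//.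
  have -> : v^T *m (Phi^T *m Phi) *m v = (Phi *m v)^T *m (Phi *m v).
    by rewrite trmx_mul !mulmxA.
  rewrite mxE sumr_ge0// => k _.
  by rewrite mxE -expr2 sqr_ge0.
have qE : (v^T *m diag_mx (\row_i (g i 0)^-1) *m v) 0 0 = \sum_i v i 0 ^+ 2 / g i 0.
  rewrite mul_mx_diag mxE; apply: eq_bigr => i _.
  by rewrite !mxE mulrAC -expr2.
have q0 i : 0 <= v i 0 ^+ 2 / g i 0 by rewrite divr_ge0 ?sqr_ge0 ?ltW.
rewrite qE lt_neqAle sumr_ge0 // andbT eq_sym; apply: contraNneq v0.
move=> /eqP; rewrite psumr_eq0// => /allP vi0.
apply/eqP/colP => i; rewrite mxE; have := vi0 i; rewrite mem_index_enum => /(_ isT).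
by rewrite mulf_eq0 invr_eq0 (gt_eqF (g_gt0 i)) orbF sqrf_eq0 => /eqP.
Qed.

Lemma residual_hybrid_parameter w :
  residual Phi (Y w) (hybrid_parameter X g w) = Z w.
Proof.
rewrite /residual /hybrid_parameter col_mxKu /Y /observation /Z /noise_x.
by rewrite addrC addKr.
Qed.

(** The off-diagonal blocks vanish because x is centred. On the last diagonal, [E[x_j^2] = gamma_j]
    turns the mean Hessian into [1 / (2 gamma_j^2) - gamma_j / gamma_j^3 = - 1 / (2 gamma_j^2)]. *)
Lemma hybrid_information_mxE :
  hybrid_information_mx (P g) Y X g (joint_pdf Phi sigma2) = information_mx.
Proof.
have sx j := sqr_integrableW _ _ _ _ _
  (sqr_integrable_x _ _ _ _ sigma2_gt0 _ _ _ _ _ X_gaussian noise_gaussian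
    X_noise_independent g j g_gt0).
have sx2 j := sqr_integrableW _ _ _ _ _
  (sqr_integrable_x2 _ _ _ _ sigma2_gt0 _ _ _ _ _ X_gaussian noise_gaussian
    X_noise_independent g j g_gt0).
have Ex j : \int[P g]_w X w j 0 = 0.
  exact: (Rintegral_x _ _ _ _ sigma2_gt0 _ _ _ _ _ X_gaussian
    noise_gaussian X_noise_independent g).
have Ex2 j : \int[P g]_w (X w j 0 ^+ 2) = g j 0.
  exact: (Rintegral_x2 _ _ _ _ sigma2_gt0 _ _ _ _ _ X_gaussian
    noise_gaussian X_noise_independent g).
have Eoff j b : \int[P g]_w (X w j 0 / g j 0 ^+ 2 *+ (b : bool)) = 0.
  case: b; last by under eq_Rintegral do rewrite mulr0n; exact: Rintegral_cst_prob.
  under eq_Rintegral do rewrite mulr1n mulrC.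
  by rewrite RintegralZ_prob// Ex mulr0.
rewrite information_mxE; apply/matrixP => i j; rewrite mxE expectation_mxE.
have pos w : positive_cV (dsubmx (hybrid_parameter X g w)) by rewrite col_mxKd.
have HE w := hessian_ln_joint_pdf _ _ _ Phi _ sigma2_gt0 (Y w) _ (pos w).
under eq_Rintegral do rewrite HE col_mxKu col_mxKd.
case: (split_ordP i) => i' ->; case: (split_ordP j) => j' ->.
- rewrite block_mxEul mxE; under eq_Rintegral do rewrite block_mxEul mxE.
  by rewrite Rintegral_cst_prob opprK.
- rewrite block_mxEur mxE; under eq_Rintegral do rewrite block_mxEur mxE.
  by rewrite Eoff oppr0.
- rewrite block_mxEdl mxE; under eq_Rintegral do rewrite block_mxEdl mxE.
  by rewrite Eoff oppr0.
- rewrite block_mxEdr mxE; under eq_Rintegral do rewrite block_mxEdr mxE.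
  have gj0 : g j' 0 != 0 by rewrite gt_eqF.
  case: eqVneq => _; last first.
    by under eq_Rintegral do rewrite mulr0n; rewrite Rintegral_cst_prob oppr0.
  under eq_Rintegral do rewrite mulr1n [X in _ - X]mulrC.
  rewrite RintegralB//; first last.
  + under [X in integrable _ _ X]eq_fun do rewrite /= EFinM.
    exact: (integrableZl measurableT _ (sx2 j')).
  + exact: (finite_measure_integrable_cst (P g) ((2 * g j' 0 ^+ 2)^-1)).
  rewrite Rintegral_cst_prob RintegralZ_prob// Ex2 mulr1n.
  by field.
Qed.

(** * Second moments of the score *)

Definition score_rv (w : Omega) : 'cV[R]_(L + L) :=
  score Phi sigma2 (Y w) (hybrid_parameter X g w).

Lemma score_rv_lshift w j :
  score_rv w (lshift L j) 0 = - precision_ip sigma2 g (Z w) (direction Phi j).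
Proof.
by rewrite /score_rv col_mxEu mxE residual_hybrid_parameter col_mxKd.
Qed.

Lemma score_rv_rshift w j : score_rv w (rshift L j) 0 =
  X w j 0 ^+ 2 / (2 * g j 0 ^+ 2) - (2 * g j 0)^-1.
Proof. by rewrite /score_rv col_mxEd mxE col_mxKu col_mxKd. Qed.

Let sqr_integrable_ip (v : 'cV[R]_N * 'cV[R]_L) g' : positive_cV g' ->
  sqr_integrable (P g') (fun w => precision_ip sigma2 g' (Z w) v).
Proof.
exact: (sqr_integrable_precision_ip _ _ _ _ sigma2_gt0 _ _ _ _ _ X_gaussian
    noise_gaussian X_noise_independent).
Qed.

Lemma sqr_integrable_score_rv i : sqr_integrable (P g) (fun w => score_rv w i 0).
Proof.
case: (split_ordP i) => j ->.
  under eq_fun do rewrite score_rv_lshift -mulN1r.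
  by apply: sqr_integrableZ; exact: sqr_integrable_ip.
under eq_fun do rewrite score_rv_rshift mulrC.
apply: sqr_integrableB; last exact: sqr_integrable_cst.
apply: sqr_integrableZ.
exact: (sqr_integrable_x2 _ _ _ _ sigma2_gt0 _ _ _ _ _ X_gaussian
    noise_gaussian X_noise_independent).
Qed.

(* [precision_ip] depends on [g], whereas the law may be that of [g']. *)
Lemma integral_precision_ip_law g' (v : 'cV[R]_N * 'cV[R]_L) : positive_cV g' ->
  (\int[P g']_w (precision_ip sigma2 g (Z w) v)%:E = 0)%E.
Proof.
(* The factor [g' k 0 / g k 0] compensates the change of precision, so the form is a centred linear
   form for the law of [g']. *)
move=> g'0; pose v' := (v.1, (\col_k (v.2 k 0 * g' k 0 / g k 0)) : 'cV[R]_L).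
have ipE w : precision_ip sigma2 g (Z w) v = precision_ip sigma2 g' (Z w) v'.
  rewrite /precision_ip; congr (_ + _); apply: eq_bigr => k _; rewrite mxE.
  by field; rewrite !gt_eqF.
under eq_integral do rewrite ipE.
have /sqr_integrableW/(integrable_fin_num measurableT)/fineK <- :=
  sqr_integrable_ip v' g' g'0.
congr (_%:E); exact: (Rintegral_precision_ip0 _ _ _ _ sigma2_gt0 _ _ _ _ _ X_gaussian
    noise_gaussian X_noise_independent).
Qed.

(** The x-block is the covariance of linear forms. In the other blocks one factor is a gamma-score,
    and the variance perturbation applies to the other factor: an x-score has mean 0 under every
    law, and a gamma-score frozen at [g] has a mean affine in the perturbed variance. *)
Lemma expectation_score_rv_sqr :
  expectation_mx (P g) (fun w => score_rv w *m (score_rv w)^T) = information_mx.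
Proof.
have EE i j : expectation_mx (P g) (fun w => score_rv w *m (score_rv w)^T) i j =
    \int[P g]_w (score_rv w i 0 * score_rv w j 0).
  rewrite expectation_mxE; apply: eq_Rintegral => w _.
  by rewrite mxE big_ord1 [_^T _ _]mxE.
have mul_lr i j := sqr_integrableM _ _ _ _ _ _
  (sqr_integrable_ip (direction Phi i) g g_gt0)
  (sqr_integrable_score_rv (rshift L j)).
have Elr i j : \int[P g]_w (- precision_ip sigma2 g (Z w) (direction Phi i) *
    (X w j 0 ^+ 2 / (2 * g j 0 ^+ 2) - (2 * g j 0)^-1)) = 0.
  transitivity (\int[P g]_w (-1 * (precision_ip sigma2 g (Z w) (direction Phi i) *
      score_rv w (rshift L j) 0))).
    by apply: eq_Rintegral => w _; rewrite score_rv_rshift mulN1r mulNr.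
  rewrite RintegralZ_prob// -[RHS](mulr0 (-1)); congr (_ * _).
  under eq_Rintegral do rewrite score_rv_rshift.
  apply: (Rintegral_score_variance _ _ _ _ sigma2_gt0 _ _ _ _ _ X_gaussian
    noise_gaussian X_noise_independent g j
    (fun z => precision_ip sigma2 g z (direction Phi i)) 0 0) => //.
  - exact: measurable_precision_ip.
  - exact: sqr_integrable_ip.
  - move=> g' g'0 _; rewrite mul0r addr0.
    exact: integral_precision_ip_law.
apply/matrixP => i j; rewrite EE information_mxE.
case: (split_ordP i) => i' ->; case: (split_ordP j) => j' ->.
- rewrite block_mxEul mxE; under eq_Rintegral do rewrite !score_rv_lshift mulrNN.
  exact: (Rintegral_precision_ip2 _ _ _ _ sigma2_gt0 _ _ _ _ _ X_gaussian
    noise_gaussian X_noise_independent).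
- rewrite block_mxEur mxE.
  by under eq_Rintegral do rewrite score_rv_lshift score_rv_rshift.
- rewrite block_mxEdl mxE.
  by under eq_Rintegral do rewrite score_rv_lshift score_rv_rshift mulrC.
- rewrite block_mxEdr mxE.
  under eq_Rintegral do rewrite !score_rv_rshift.
  pose k : R := (2 * g j' 0 ^+ 2)^-1 *+ (i' == j').
  pose a : R := - (2 * g j' 0)^-1 *+ (i' == j').
  apply: (Rintegral_score_variance _ _ _ _ sigma2_gt0 _ _ _ _ _ X_gaussian
    noise_gaussian X_noise_independent g j'
    (fun z => z.2 i' 0 ^+ 2 / (2 * g i' 0 ^+ 2) - (2 * g i' 0)^-1) a k) => //.
  + apply: measurable_funB => //; apply: measurable_funM => //.
    by have mi := measurable_snd_coord R N L i'; exact: measurable_funX.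
  + by have := sqr_integrable_score_rv (rshift L i');
      under eq_fun do rewrite score_rv_rshift.
  + move=> g' g'0 g'E.
    have sx2 := sqr_integrableW _ _ _ _ _ (sqr_integrable_x2 _ _ _ _ sigma2_gt0 _ _ _ _ _ X_gaussian
    noise_gaussian X_noise_independent g' i' g'0).
    have ss : sqr_integrable (P g') (fun w =>
        X w i' 0 ^+ 2 / (2 * g i' 0 ^+ 2) - (2 * g i' 0)^-1).
      apply: sqr_integrableB; last exact: sqr_integrable_cst.
      under eq_fun do rewrite mulrC; apply: sqr_integrableZ.
      exact: (sqr_integrable_x2 _ _ _ _ sigma2_gt0 _ _ _ _ _ X_gaussian
    noise_gaussian X_noise_independent).
    have /sqr_integrableW/(integrable_fin_num measurableT)/fineK <- := ss.
    congr (_%:E).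
    transitivity (\int[P g']_w ((2 * g i' 0 ^+ 2)^-1 * X w i' 0 ^+ 2 -
      (2 * g i' 0)^-1)).
      by apply: eq_Rintegral => w _; rewrite mulrC.
    rewrite RintegralB//; first last.
    * exact: (finite_measure_integrable_cst (P g') ((2 * g i' 0)^-1)).
    * under [X in integrable _ _ X]eq_fun do rewrite /= EFinM.
      exact: (integrableZl measurableT _ sx2).
    rewrite RintegralZ_prob// Rintegral_cst_prob.
    rewrite (Rintegral_x2 _ _ _ _ sigma2_gt0 _ _ _ _ _ X_gaussian
    noise_gaussian X_noise_independent g' i' g'0) /a /k.
    have gi0 : g i' 0 != 0 by rewrite gt_eqF.
    have [<-|ij] := eqVneq i' j'; first by rewrite !mulr1n; ring.
    by rewrite g'E// !mulr0n; field.
Qed.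

Lemma measurable_mulmx_cV : measurable_fun setT (fun x : 'cV[R]_L => Phi *m x).
Proof.
apply/measurable_fun_cVP => i; under eq_fun do rewrite mxE.
apply: measurable_sum => k; apply: measurable_funM => //.
exact: measurable_coord.
Qed.

(** The map from [(noise, x)] to [(y, x)] is a shear. This certifies that [joint_pdf], from which H
    is formed, is the density of the observed model. *)
Lemma has_density_observation :
  has_density (P g) (lebesgue_cV N \x lebesgue_cV L)%E
    (fun w => (Y w, X w)) (fun yx => joint_pdf Phi sigma2 yx.1 yx.2 g).
Proof.
rewrite (_ : (fun yx => _) = fun t : 'cV[R]_N * 'cV[R]_L =>
  noise_x_pdf sigma2 g (t.1 - Phi *m t.2, t.2)); last first.
  by apply/funext => t; rewrite joint_pdf_noise_x_pdf.
apply: (has_density_add_pair _ _ _ _ _ noise X (noise_x_pdf sigma2 g)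
  (fun x => Phi *m x)) => //.
- exact: measurable_noise_x_pdf.
- exact: measurable_mulmx_cV.
- exact: noise_x_pdf_ge0.
- exact: (has_density_noise_x _ _ _ _ sigma2_gt0 _ _ _ _ _ X_gaussian
    noise_gaussian X_noise_independent).
Qed.

(** * Correlation of the estimation error with the score *)

Section estimator.
Variable est : {mfun 'cV[R]_N >-> 'cV[R]_(L + L)}.
Hypothesis est_unbiased :
  forall g', positive_cV g' -> hybrid_unbiased (P g') Y X g' est.
Hypothesis est_sqr_integrable :
  integrable_mx (P g) (squared_error_mx Y X g est).

Let e := estimation_error Y X g est.

(* The estimation error as a function of [Z]; the parameter stays at [g] when
   the law is changed. *)
Let err i (z : 'cV[R]_N * 'cV[R]_L) : R :=
  (col_mx z.2 g : 'cV[R]_(L + L)) i 0 - est (Phi *m z.2 + z.1) i 0.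

Let errE w i : err i (Z w) = e w i 0.
Proof. by rewrite /e /estimation_error [RHS]mxE [X in _ = _ + X]mxE. Qed.

Let measurable_hybrid i :
  measurable_fun setT (fun z : 'cV[R]_N * 'cV[R]_L => (col_mx z.2 g : 'cV[R]_(L + L)) i 0).
Proof.
case: (split_ordP i) => j ->.
  by under eq_fun do rewrite col_mxEu; exact: measurable_snd_coord.
by under eq_fun do rewrite col_mxEd; exact: measurable_cst.
Qed.

Let measurable_err i : measurable_fun setT (err i).
Proof.
apply: measurable_funB; first exact: measurable_hybrid.
have mobs : measurable_fun setT
    (fun z : 'cV[R]_N * 'cV[R]_L => Phi *m z.2 + z.1).
  apply/measurable_fun_cVP => k; under eq_fun do rewrite mxE.
  apply: measurable_funD.
    have /measurable_fun_cVP := measurableT_comp measurable_mulmx_cV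
      (@measurable_snd _ _ 'cV[R]_N 'cV[R]_L).
    exact.
  exact: (measurableT_comp (measurable_coord k) measurable_fst).
have mest : measurable_fun setT (est : 'cV[R]_N -> _) by [].
exact: (measurableT_comp (measurable_coord i) (measurableT_comp mest mobs)).
Qed.

Lemma sqr_integrable_estimation_error i : sqr_integrable (P g) (fun w => e w i 0).
Proof.
split.
  under eq_fun do rewrite -errE.
  exact: (measurableT_comp (measurable_err i) (measurable_noise_x _ _ _ _ _ X noise)).
have := est_sqr_integrable i i; congr (integrable _ _ _); apply/funext => w.
by rewrite /squared_error_mx mxE big_ord1 [_^T _ _]mxE -/e expr2.
Qed.

(** In the x-columns the translation fixes the observation, hence the estimate, so the error moves
    by exactly [h] in one coordinate and Stein's identity applies. In the gamma-columns the mean of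
    the error under the perturbed law is given by unbiasedness there. *)
Lemma expectation_error_score_rv :
  expectation_mx (P g) (fun w => e w *m (score_rv w)^T) = - 1%:M.
Proof.
apply/matrixP => i j; rewrite expectation_mxE.
transitivity (\int[P g]_w (err i (Z w) * score_rv w j 0)).
  by apply: eq_Rintegral => w _; rewrite errE mxE big_ord1 [_^T _ _]mxE.
have serr : sqr_integrable (P g) (fun w => err i (Z w)).
  by under eq_fun do rewrite errE; exact: sqr_integrable_estimation_error.
rewrite !mxE; case: (split_ordP j) => j' ->.
  transitivity (\int[P g]_w (-1 * (err i (Z w) *
      precision_ip sigma2 g (Z w) (direction Phi j')))).
    by apply: eq_Rintegral => w _; rewrite score_rv_lshift mulrN mulN1r.
  rewrite RintegralZ_prob; last by apply: sqr_integrableM => //; exact: sqr_integrable_ip.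
  rewrite mulN1r; congr (- _).
  apply: (Rintegral_precision_ip _ _ _ _ sigma2_gt0 _ _ _ _ _ X_gaussian
    noise_gaussian X_noise_independent g (err i)) => // h z.
  rewrite /err /=.
  have -> : Phi *m (z.2 - h *: delta_mx j' 0) + (z.1 - h *: - (Phi *m delta_mx j' 0)) =
      Phi *m z.2 + z.1.
    by rewrite mulmxBr -scalemxAr scalerN opprK addrACA addNr addr0.
  rewrite addrAC; congr (_ - _); case: (split_ordP i) => i' ->.
    by rewrite !col_mxEu !mxE eq_lshift eqxx andbT.
  by rewrite !col_mxEd eq_rlshift mulr0 subr0.
transitivity (\int[P g]_w (err i (Z w) *
    (X w j' 0 ^+ 2 / (2 * g j' 0 ^+ 2) - (2 * g j' 0)^-1))).
  by apply: eq_Rintegral => w _; rewrite score_rv_rshift.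
(* The error frozen at [g] exceeds the error at [g'] by [b * (g j' - g' j')]. The latter has mean 0
   under [P g'], so the intercept is [b * g j'] and the slope [- b]. *)
pose b : R := (i == rshift L j')%:R.
apply: (Rintegral_score_variance _ _ _ _ sigma2_gt0 _ _ _ _ _ X_gaussian
    noise_gaussian X_noise_independent g j' (err i) (b * g j' 0) (- b)) => //.
move=> g' g'0 g'E.
have [ie' /matrixP/(_ i 0)] := est_unbiased g' g'0.
rewrite expectation_mxE [RHS]mxE => Ee'.
have errE' w : err i (Z w) = estimation_error Y X g' est w i 0 + b * (g j' 0 - g' j' 0).
  rewrite /err /estimation_error /hybrid_parameter [in RHS]mxE [X in _ = _ + X + _]mxE.
  rewrite addrAC; congr (_ - _); rewrite /b; case: (split_ordP i) => i' ->.
    by rewrite !col_mxEu eq_lrshift mul0r addr0.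
  rewrite !col_mxEd eq_rshift; have [->|ij] := eqVneq i' j'.
    by rewrite mul1r addrC subrK.
  by rewrite (g'E i' ij) mul0r addr0.
have ierr : (P g').-integrable setT (EFin \o (fun w => err i (Z w))).
  under [X in integrable _ _ X]eq_fun do rewrite /= errE' EFinD.
  exact: (integrableD measurableT (ie' i 0)
    (finite_measure_integrable_cst (P g') (b * (g j' 0 - g' j' 0)) measurableT)).
have /(integrable_fin_num measurableT)/fineK <- := ierr; congr (_%:E).
transitivity (\int[P g']_w (estimation_error Y X g' est w i 0 +
    b * (g j' 0 - g' j' 0))).
  by apply: eq_Rintegral => w _; rewrite errE'.
rewrite RintegralD//; first last.
- exact: (finite_measure_integrable_cst (P g') (b * (g j' 0 - g' j' 0))).
- exact: (ie' i 0).
by rewrite Ee' Rintegral_cst_prob; ring.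
Qed.

Lemma hybrid_cramer_rao :
  loewner_ge (mse_mx (P g) Y X g est) (invmx information_mx).
Proof.
apply: (loewner_ge_inv_information (P g) (L + L) e score_rv).
- exact: sqr_integrable_estimation_error.
- exact: sqr_integrable_score_rv.
- exact: information_mx_unit.
- exact: trmx_information_mx.
- exact: expectation_score_rv_sqr.
- exact: expectation_error_score_rv.
Qed.

End estimator.

End information.

Theorem proposition1 (R : realType) (N L : nat) (N_gt0 : (0 < N)%N)
  (L_gt0 : (0 < L)%N) (Phi : 'M[R]_(N, L)) (sigma2 : R)
  (sigma2_gt0 : 0 < sigma2)
  (d : measure_display) (Omega : measurableType d)
  (P : 'cV[R]_L -> probability Omega R)
  (X : {mfun Omega >-> 'cV[R]_L}) (noise : {mfun Omega >-> 'cV[R]_N})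
  (X_gaussian : forall g, positive_cV g -> gaussian (P g) X 0 (Upsilon g))
  (noise_gaussian : forall g, positive_cV g ->
    gaussian (P g) noise 0 sigma2%:M)
  (X_noise_independent : forall g, positive_cV g ->
    independent (P g) X noise)
  (gamma : 'cV[R]_L) (gamma_gt0 : positive_cV gamma) :
  let Y := observation Phi X noise in
  let H := hybrid_information_mx (P gamma) Y X gamma (joint_pdf Phi sigma2) in
  [/\ has_density (P gamma) (lebesgue_cV N \x lebesgue_cV L)%E
        (fun w => (Y w, X w)) (fun yx => joint_pdf Phi sigma2 yx.1 yx.2 gamma),
      H = block_mx
            (sigma2^-1 *: (Phi^T *m Phi) + invmx (Upsilon gamma)) 0
            0 (invmx (diag_mx (\row_i (2 * gamma i ord0 ^+ 2)))),
      H \in unitmx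
    & forall est : {mfun 'cV[R]_N >-> 'cV[R]_(L + L)},
        (forall g, positive_cV g -> hybrid_unbiased (P g) Y X g est) ->
        integrable_mx (P gamma) (squared_error_mx Y X gamma est) ->
        loewner_ge (mse_mx (P gamma) Y X gamma est) (invmx H)].
Proof.
move=> Y H.
have HE : H = information_mx R N L Phi sigma2 gamma by exact: hybrid_information_mxE.
have uH : H \in unitmx by rewrite HE; exact: information_mx_unit.
split => //; first exact: has_density_observation.
move=> est est_unbiased est_sqr; rewrite HE.
exact: (hybrid_cramer_rao _ _ _ _ _ sigma2_gt0 _ _ P X noise).
Qed.
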